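(* In the setting described in the context, a complete set of representatives of the indecomposable elements of $\mathcal{O}_K^+$ modulo multiplication by totally positive units is given by \[ 1,\qquad \rho,\qquad \gamma_j\ (1\le j\le 6n+1). \] Hence $\iota(K)=6n+3$, and \[ \frac{\log\Delta_K}{8w}\le\iota(K)\le\frac{\log\Delta_K}{8w}+1,\qquad w:=\log\Big(\tfrac{1+\sqrt5}{2}\Big), \] where $\Delta_K$ is the discriminant of $K$.
   Context: For integers $m\ge0$ define integers $x_m,y_m$ by $\frac{x_m+y_m\sqrt5}{2}=\big(\frac{1+\sqrt5}{2}\big)^m$. Let $n\ge0$ be an integer such that $p:=y_{12n+3}^2-1$ and $r:=x_{12n+3}^2-1$ are squarefree, and let $K=\mathbb{Q}(\sqrt5,\sqrt p)$ (note $r=5p$, so $\sqrt r\in K$). Write $X=x_{12n+3}$, $Y=y_{12n+3}$, and $[a,b,c,d]:=a+b\sqrt5+c\sqrt p+d\sqrt r$. Define $\rho:=[\frac{X+Y}{2},0,-\frac12,\frac12]$ and, for $1\le j\le 6n+1$, \[ \gamma_j:=\Big[\frac{y_{2j-1}X+1}{2},\ \frac{x_{2j-1}X-(-1)^j}{10},\ (-1)^j\frac{x_{2j-1}}{2},\ (-1)^j\frac{y_{2j-1}}{2}\Big]. \] $\mathcal{O}_K^+$ is the set of totally positive elements of $\mathcal{O}_K$; $\alpha\in\mathcal{O}_K^+$ is indecomposable if it is not a sum of two elements of $\mathcal{O}_K^+$; $\iota(K)$ is the number of indecomposables up to multiplication by totally positive units. *)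

(* Defs.v *)
From Stdlib Require Import Reals ZArith.
Open Scope R_scope.

(* Model of K = Q(sqrt5, sqrt p): an element [a,b,c,d] = a + b sqrt5 + c sqrt p + d sqrt(5p),
   stored by its four coordinates; membership in K requires rational coordinates. *)
Record el := El { e0 : R; e1 : R; e2 : R; e3 : R }.

Definition isQ (t : R) : Prop := exists a b : Z, b <> 0%Z /\ t = IZR a / IZR b.
Definition inK (a : el) : Prop := isQ (e0 a) /\ isQ (e1 a) /\ isQ (e2 a) /\ isQ (e3 a).

Definition el0 : el := El 0 0 0 0.
Definition el1 : el := El 1 0 0 0.
Definition eladd (a b : el) : el :=
  El (e0 a + e0 b) (e1 a + e1 b) (e2 a + e2 b) (e3 a + e3 b).
Definition elscale (c : R) (a : el) : el :=
  El (c * e0 a) (c * e1 a) (c * e2 a) (c * e3 a).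

(* multiplication, using sqrt5^2 = 5, sqrtp^2 = p, sqrt5 sqrtp = sqrt(5p), etc. *)
Definition elmul (p : Z) (a b : el) : el :=
  let P := IZR p in
  El (e0 a * e0 b + 5 * e1 a * e1 b + P * e2 a * e2 b + 5 * P * e3 a * e3 b)
     (e0 a * e1 b + e1 a * e0 b + P * (e2 a * e3 b + e3 a * e2 b))
     (e0 a * e2 b + e2 a * e0 b + 5 * (e1 a * e3 b + e3 a * e1 b))
     (e0 a * e3 b + e3 a * e0 b + e1 a * e2 b + e2 a * e1 b).

Fixpoint elpow (p : Z) (a : el) (k : nat) : el :=
  match k with O => el1 | S k' => elmul p a (elpow p a k') end.

Fixpoint polyval (p : Z) (c : nat -> Z) (a : el) (k : nat) : el :=
  match k with
  | O => el0
  | S k' => eladd (polyval p c a k') (elscale (IZR (c k')) (elpow p a k'))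
  end.

Definition in_OK (p : Z) (a : el) : Prop :=
  inK a /\ exists (d : nat) (c : nat -> Z), eladd (elpow p a d) (polyval p c a d) = el0.

Definition sg (b : bool) : R := if b then 1 else -1.

Definition sigma (p : Z) (s1 s2 : bool) (a : el) : R :=
  e0 a + sg s1 * e1 a * sqrt 5 + sg s2 * e2 a * sqrt (IZR p)
  + sg s1 * sg s2 * e3 a * sqrt (5 * IZR p).

Definition totpos (p : Z) (a : el) : Prop :=
  in_OK p a /\ forall s1 s2 : bool, 0 < sigma p s1 s2 a.

Definition indec (p : Z) (a : el) : Prop :=
  totpos p a /\ ~ (exists b c : el, totpos p b /\ totpos p c /\ a = eladd b c).

Definition is_unit (p : Z) (e : el) : Prop :=
  in_OK p e /\ exists f : el, in_OK p f /\ elmul p e f = el1.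

Definition tp_unit (p : Z) (e : el) : Prop := is_unit p e /\ totpos p e.

Definition assoc (p : Z) (a b : el) : Prop :=
  exists e : el, tp_unit p e /\ a = elmul p e b.

Definition complete_reps (p : Z) (m : nat) (f : nat -> el) : Prop :=
  (forall i, (i < m)%nat -> indec p (f i)) /\
  (forall i k, (i < m)%nat -> (k < m)%nat -> i <> k -> ~ assoc p (f i) (f k)) /\
  (forall a, indec p a -> exists i, (i < m)%nat /\ assoc p a (f i)).

Definition iota_eq (p : Z) (m : nat) : Prop := exists f : nat -> el, complete_reps p m f.

Fixpoint zcomb (z : nat -> Z) (w : nat -> el) (k : nat) : el :=
  match k with
  | O => el0
  | S k' => eladd (zcomb z w k') (elscale (IZR (z k')) (w k'))
  end.

Definition integral_basis (p : Z) (w : nat -> el) : Prop :=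
  (forall i, (i < 4)%nat -> in_OK p (w i)) /\
  (forall a, in_OK p a -> exists z : nat -> Z, a = zcomb z w 4) /\
  (forall z : nat -> Z, zcomb z w 4 = el0 -> forall i, (i < 4)%nat -> z i = 0%Z).

Definition emb1 (k : nat) : bool := match k with 0%nat | 1%nat => true | _ => false end.
Definition emb2 (k : nat) : bool := match k with 0%nat | 2%nat => true | _ => false end.

Definition det3 (m : nat -> nat -> R) (r0 r1 r2 c0 c1 c2 : nat) : R :=
  m r0 c0 * (m r1 c1 * m r2 c2 - m r1 c2 * m r2 c1)
  - m r0 c1 * (m r1 c0 * m r2 c2 - m r1 c2 * m r2 c0)
  + m r0 c2 * (m r1 c0 * m r2 c1 - m r1 c1 * m r2 c0).

Definition det4 (m : nat -> nat -> R) : R :=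
  m 0%nat 0%nat * det3 m 1 2 3 1 2 3 - m 0%nat 1%nat * det3 m 1 2 3 0 2 3
  + m 0%nat 2%nat * det3 m 1 2 3 0 1 3 - m 0%nat 3%nat * det3 m 1 2 3 0 1 2.

Definition disc_eq (p : Z) (D : R) : Prop :=
  exists w : nat -> el, integral_basis p w /\
    D = (det4 (fun k j => sigma p (emb1 k) (emb2 k) (w j))) ^ 2.

Definition Zsqfree (z : Z) : Prop := forall d : Z, (d * d | z)%Z -> Z.abs d = 1%Z.

(* Main.v *)
From Stdlib Require Import Reals ZArith Lra Lia Znumtheory.
Require Import Defs.
Open Scope R_scope.

(** Write phi = (1 + sqrt 5)/2, A = Z[phi], h = 3n + 1, eps = Y + sqrt p, eta = X + sqrt r.  The
    hypotheses give O_K = A + A sqrt p, and eps, eta, phi^2 are totally positive units.  Taking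
    logarithms of the ratios of the two embeddings above each place of Q(sqrt 5), the units eps and
    eta generate the lattice spanned by (E,E) and (G,-G), where E = log eps <= G = log eta (up to a
    common factor), so modulo units every totally positive element lies, at both places, either in
    the cone spanned by 1 and eps or in the cone spanned by 1 and eta.

    The first cone is unimodular over A, so its only indecomposables are units.  In the second one
    an integer is l + m eta with l, m in A/sqrt 5 totally nonnegative and congruent modulo A, and
    its indecomposables are, up to units, 1 and some of the delta_i = tau (1 + phi^(4i) eta), i in
    Z, where tau = 1/(sqrt 5 phi).  Now gamma_j = delta_(j/2) for j even, gamma_j is phi^2 times the
    conjugate of delta_((j-1)/2), hence associated to delta_(-(j-1)/2), for j odd, and rho is
    associated to delta_(-h), which is associated to delta_h.

    For |i| <= h a positive element of the codifferent has trace 1 against delta_i, up to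
    conjugation, so delta_i is indecomposable.  For i > h it exceeds the unit phi^(4h) eps.  The
    norm of delta_i is ((2X + phi^(4i) + phi^(-4i))/5)^2, which determines |i|, and
    delta_i / delta_(-i) is not integral for 0 < i < h. *)

(** * The algebra [el] and its conjugations *)

Lemma el_ext (a b : el) :
  e0 a = e0 b -> e1 a = e1 b -> e2 a = e2 b -> e3 a = e3 b -> a = b.
Proof. destruct a, b; simpl; intros; congruence. Qed.

Definition elopp (a : el) : el := El (- e0 a) (- e1 a) (- e2 a) (- e3 a).
Definition elsub (a b : el) : el := eladd a (elopp b).

Ltac el_ring := intros; apply el_ext; simpl; ring.

Lemma el_ring_theory (p : Z) :
  ring_theory el0 el1 eladd (elmul p) elsub elopp (@eq el).
Proof. split; try reflexivity; el_ring. Qed.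

Lemma elscale_add (c : R) (a b : el) :
  elscale c (eladd a b) = eladd (elscale c a) (elscale c b).
Proof. el_ring. Qed.

Definition elconj (s t : bool) (a : el) : el :=
  El (e0 a) (sg s * e1 a) (sg t * e2 a) (sg s * sg t * e3 a).

Lemma elconj_mul (p : Z) (s t : bool) (a b : el) :
  elconj s t (elmul p a b) = elmul p (elconj s t a) (elconj s t b).
Proof. destruct s, t; el_ring. Qed.

Lemma elconj_add (s t : bool) (a b : el) :
  elconj s t (eladd a b) = eladd (elconj s t a) (elconj s t b).
Proof. el_ring. Qed.

Lemma elconj_pow (p : Z) (s t : bool) (a : el) (k : nat) :
  elconj s t (elpow p a k) = elpow p (elconj s t a) k.
Proof.
  induction k as [|k IH]; simpl; [el_ring|].
  now rewrite elconj_mul, IH.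
Qed.

Lemma elconj_involutive (s t : bool) (a : el) : elconj s t (elconj s t a) = a.
Proof. destruct s, t; el_ring. Qed.

Section ElRing.
Variable p : Z.
Add Ring el_ring_pow : (el_ring_theory p).

Lemma elpow_add (a : el) (i j : nat) :
  elpow p a (i + j) = elmul p (elpow p a i) (elpow p a j).
Proof. induction i as [|i IH]; simpl; [|rewrite IH]; ring. Qed.

Lemma elpow_mul_distr (a b : el) (k : nat) :
  elpow p (elmul p a b) k = elmul p (elpow p a k) (elpow p b k).
Proof. induction k as [|k IH]; simpl; [|rewrite IH]; ring. Qed.

Lemma elpow_rational (t : R) (k : nat) : elpow p (El t 0 0 0) k = El (t ^ k) 0 0 0.
Proof. induction k as [|k IH]; simpl; [reflexivity|rewrite IH; el_ring]. Qed.

End ElRing.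

(** * Integrality *)

Definition isZ (t : R) : Prop := exists z : Z, t = IZR z.

Lemma isZ_IZR (z : Z) : isZ (IZR z).
Proof. now exists z. Qed.

Lemma isZ_add (s t : R) : isZ s -> isZ t -> isZ (s + t).
Proof. intros [a ->] [b ->]; exists (a + b)%Z; now rewrite plus_IZR. Qed.

Lemma isZ_mul (s t : R) : isZ s -> isZ t -> isZ (s * t).
Proof. intros [a ->] [b ->]; exists (a * b)%Z; now rewrite mult_IZR. Qed.

Lemma isZ_opp (s : R) : isZ s -> isZ (- s).
Proof. intros [a ->]; exists (- a)%Z; now rewrite opp_IZR. Qed.

Lemma isZ_sub (s t : R) : isZ s -> isZ t -> isZ (s - t).
Proof. intros Hs Ht; apply isZ_add; [|apply isZ_opp]; assumption. Qed.

#[local] Hint Resolve isZ_IZR isZ_add isZ_mul isZ_opp isZ_sub : isz.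

Lemma isZ_pos_ge_1 (t : R) : isZ t -> 0 < t -> 1 <= t.
Proof. intros [z ->] H; apply lt_IZR in H; apply IZR_le; lia. Qed.

Definition integral_coords (a : el) : Prop :=
  isZ (e0 a) /\ isZ (e1 a) /\ isZ (e2 a) /\ isZ (e3 a).

Lemma integral_coords_add (a b : el) :
  integral_coords a -> integral_coords b -> integral_coords (eladd a b).
Proof. intros (?&?&?&?) (?&?&?&?); repeat split; simpl; auto with isz. Qed.

Lemma integral_coords_scale (z : Z) (a : el) :
  integral_coords a -> integral_coords (elscale (IZR z) a).
Proof. intros (?&?&?&?); repeat split; simpl; auto with isz. Qed.

Lemma integral_coords_mul (p : Z) (a b : el) :
  integral_coords a -> integral_coords b -> integral_coords (elmul p a b).
Proof. intros (?&?&?&?) (?&?&?&?); repeat split; simpl; auto 10 with isz. Qed.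

Lemma integral_coords_conj (s t : bool) (a : el) :
  integral_coords a -> integral_coords (elconj s t a).
Proof.
  assert (Hs : forall b, isZ (sg b)) by (intros []; simpl; auto with isz).
  intros (?&?&?&?); repeat split; simpl; auto with isz.
Qed.

Lemma isQ_IZR (z : Z) : isQ (IZR z).
Proof. exists z, 1%Z; split; [lia|field]. Qed.

Lemma isQ_add (s t : R) : isQ s -> isQ t -> isQ (s + t).
Proof.
  intros (a&b&Hb&->) (c&d&Hd&->); exists (a * d + c * b)%Z, (b * d)%Z; split; [nia|].
  rewrite plus_IZR, !mult_IZR; field; split; now apply not_0_IZR.
Qed.

Lemma isQ_mul (s t : R) : isQ s -> isQ t -> isQ (s * t).
Proof.
  intros (a&b&Hb&->) (c&d&Hd&->); exists (a * c)%Z, (b * d)%Z; split; [nia|].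
  rewrite !mult_IZR; field; split; now apply not_0_IZR.
Qed.

Lemma isQ_denominator (t : R) : isQ t -> exists N : Z, (0 < N)%Z /\ isZ (IZR N * t).
Proof.
  intros (a&b&Hb&->); exists (b * b)%Z; split; [nia|].
  exists (b * a)%Z; rewrite !mult_IZR; field; now apply not_0_IZR.
Qed.

Lemma isQ_lowest_terms (t : R) :
  isQ t -> exists a b : Z, b <> 0%Z /\ rel_prime a b /\ t = IZR a / IZR b.
Proof.
  intros (a&b&Hb&->).
  remember (Z.gcd a b) as g eqn:Hg.
  assert (Hg0 : g <> 0%Z) by (intros ->; symmetry in Hg; now apply Z.gcd_eq_0_r in Hg).
  destruct (Z.gcd_divide_l a b) as (a'&Ha), (Z.gcd_divide_r a b) as (b'&Hb').
  rewrite <- Hg in Ha, Hb'.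
  assert (Hb0 : b' <> 0%Z) by (intros ->; lia).
  exists a', b'; split; [assumption|split].
  - apply Zgcd_1_rel_prime.
    rewrite <- (Z.gcd_div_gcd a b g Hg0 Hg), Ha, Hb'; now rewrite !Z.div_mul.
  - rewrite Ha, Hb', !mult_IZR; field; split; now apply not_0_IZR.
Qed.

Lemma inK_mul (p : Z) (a b : el) : inK a -> inK b -> inK (elmul p a b).
Proof.
  intros (?&?&?&?) (?&?&?&?); repeat split; simpl; auto 10 using isQ_IZR, isQ_add, isQ_mul.
Qed.

Lemma inK_pow (p : Z) (a : el) (k : nat) : inK a -> inK (elpow p a k).
Proof.
  intros Ha; induction k as [|k IH]; simpl; [|now apply inK_mul].
  repeat split; apply isQ_IZR.
Qed.

Lemma inK_denominator (a : el) :
  inK a -> exists N : Z, (0 < N)%Z /\ integral_coords (elscale (IZR N) a).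
Proof.
  intros (Q0&Q1&Q2&Q3).
  destruct (isQ_denominator _ Q0) as (n0&P0&Z0), (isQ_denominator _ Q1) as (n1&P1&Z1),
    (isQ_denominator _ Q2) as (n2&P2&Z2), (isQ_denominator _ Q3) as (n3&P3&Z3).
  exists (n0 * n1 * n2 * n3)%Z; split; [nia|].
  repeat split; simpl; rewrite !mult_IZR.
  - replace (_ * _) with (IZR n1 * IZR n2 * IZR n3 * (IZR n0 * e0 a)) by ring; auto with isz.
  - replace (_ * _) with (IZR n0 * IZR n2 * IZR n3 * (IZR n1 * e1 a)) by ring; auto with isz.
  - replace (_ * _) with (IZR n0 * IZR n1 * IZR n3 * (IZR n2 * e2 a)) by ring; auto with isz.
  - replace (_ * _) with (IZR n0 * IZR n1 * IZR n2 * (IZR n3 * e3 a)) by ring; auto with isz.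
Qed.

Lemma inK_powers_denominator (p : Z) (a : el) (d : nat) :
  inK a -> exists N : Z, (0 < N)%Z /\
    forall k, (k < d)%nat -> integral_coords (elscale (IZR N) (elpow p a k)).
Proof.
  intros Ha; induction d as [|d (N&HN&IH)]; [exists 1%Z; split; lia|].
  destruct (inK_denominator _ (inK_pow p a d Ha)) as (M&HM&HL).
  exists (M * N)%Z; split; [nia|]; intros k Hk; rewrite mult_IZR.
  destruct (Nat.eq_dec k d) as [->|Hkd].
  - replace (elscale _ _) with (elscale (IZR N) (elscale (IZR M) (elpow p a d))) by el_ring.
    now apply integral_coords_scale.
  - replace (elscale _ _) with (elscale (IZR M) (elscale (IZR N) (elpow p a k))) by el_ring.
    apply integral_coords_scale, IH; lia.
Qed.

Lemma pow_bounded_denominator_zero (N : Z) (f : R) :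
  (0 < N)%Z -> 0 <= f < 1 -> (forall k, isZ (IZR N * f ^ k)) -> f = 0.
Proof.
  intros HN Hf HZ; apply IZR_lt in HN.
  destruct (pow_lt_1_zero f) with (y := / IZR N) as (k&Hk).
  { rewrite Rabs_pos_eq; lra. }
  { now apply Rinv_0_lt_compat. }
  specialize (Hk k (le_n k)).
  assert (Hfk : 0 <= f ^ k) by (apply pow_le; lra).
  rewrite Rabs_pos_eq in Hk by assumption.
  assert (Hsmall : IZR N * f ^ k < 1).
  { rewrite <- (Rinv_r (IZR N)) by lra; now apply Rmult_lt_compat_l. }
  destruct (Req_dec f 0) as [|Hne]; [assumption|exfalso].
  assert (Hpos : 0 < f ^ k) by (apply pow_lt; lra).
  pose proof (isZ_pos_ge_1 _ (HZ k) (Rmult_lt_0_compat _ _ HN Hpos)); lra.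
Qed.

Section AlmostIntegral.
Variable p : Z.
Add Ring el_ring_almost_integral : (el_ring_theory p).

(* Unlike the existence of a monic equation, boundedness of the denominators of the powers is
   visibly preserved by conjugations, products and sums. *)
Definition almost_integral (a : el) : Prop :=
  exists N : Z, (0 < N)%Z /\ forall k, integral_coords (elscale (IZR N) (elpow p a k)).

Lemma integral_coords_polyval (N : Z) (c : nat -> Z) (a : el) (k d : nat) :
  (forall j, (j < d)%nat -> integral_coords (elscale (IZR N) (elpow p a (k + j)))) ->
  integral_coords (elscale (IZR N) (elmul p (elpow p a k) (polyval p c a d))).
Proof.
  induction d as [|d IH]; intros H; simpl.
  - replace (elmul _ _ _) with el0 by ring.
    repeat split; simpl; rewrite Rmult_0_r; auto with isz.
  - replace (elscale (IZR N) _) with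
      (eladd (elscale (IZR N) (elmul p (elpow p a k) (polyval p c a d)))
             (elscale (IZR (c d)) (elscale (IZR N) (elpow p a (k + d)))))
      by (rewrite elpow_add; el_ring).
    apply integral_coords_add; [|apply integral_coords_scale]; auto.
Qed.

Lemma in_OK_almost_integral (a : el) : in_OK p a -> almost_integral a.
Proof.
  intros (Ha&d&c&Hc).
  destruct (inK_powers_denominator p a d Ha) as (N&HN&HL).
  exists N; split; [assumption|].
  induction k as [k IH] using (well_founded_induction lt_wf).
  destruct (Nat.lt_ge_cases k d) as [Hk|Hk]; [now apply HL|].
  assert (Hd : (0 < d)%nat).
  { destruct d; [|lia]; exfalso; apply (f_equal e0) in Hc; simpl in Hc; lra. }
  replace (elpow p a k) with
    (elopp (elmul p (elpow p a (k - d)) (polyval p c a d))).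
  - replace (elscale (IZR N) _) with (elscale (IZR (-1))
      (elscale (IZR N) (elmul p (elpow p a (k - d)) (polyval p c a d)))) by el_ring.
    apply integral_coords_scale, integral_coords_polyval; intros j Hj; apply IH; lia.
  - replace k with ((k - d) + d)%nat at 2 by lia; rewrite elpow_add.
    replace (elpow p a d) with (elsub (eladd (elpow p a d) (polyval p c a d)) (polyval p c a d))
      by ring.
    rewrite Hc; ring.
Qed.

Lemma almost_integral_conj (s t : bool) (a : el) :
  almost_integral a -> almost_integral (elconj s t a).
Proof.
  intros (N&HN&H); exists N; split; [assumption|]; intros k.
  rewrite <- elconj_pow.
  replace (elscale _ _) with (elconj s t (elscale (IZR N) (elpow p a k))) by el_ring.
  apply integral_coords_conj, H.
Qed.

Lemma almost_integral_mul (a b : el) :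
  almost_integral a -> almost_integral b -> almost_integral (elmul p a b).
Proof.
  intros (N&HN&Ha) (M&HM&Hb); exists (N * M)%Z; split; [nia|]; intros k.
  rewrite elpow_mul_distr, mult_IZR.
  replace (elscale _ _) with
    (elmul p (elscale (IZR N) (elpow p a k)) (elscale (IZR M) (elpow p b k))) by el_ring.
  now apply integral_coords_mul.
Qed.

Lemma almost_integral_add (a b : el) :
  almost_integral a -> almost_integral b -> almost_integral (eladd a b).
Proof.
  intros (N&HN&Ha) (M&HM&Hb); exists (N * M)%Z; split; [nia|].
  assert (Hbinomial : forall k i j, integral_coords (elscale (IZR (N * M))
    (elmul p (elpow p (eladd a b) k) (elmul p (elpow p a i) (elpow p b j))))).
  { induction k as [|k IH]; intros i j; rewrite mult_IZR; simpl.
    - replace (elscale _ _) with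
        (elmul p (elscale (IZR N) (elpow p a i)) (elscale (IZR M) (elpow p b j))) by el_ring.
      now apply integral_coords_mul.
    - replace (elmul p (elmul p (eladd a b) _) _) with
        (eladd (elmul p (elpow p (eladd a b) k) (elmul p (elpow p a (S i)) (elpow p b j)))
               (elmul p (elpow p (eladd a b) k) (elmul p (elpow p a i) (elpow p b (S j)))))
        by (simpl; ring).
      rewrite elscale_add, <- mult_IZR; now apply integral_coords_add. }
  intros k; replace (elpow p (eladd a b) k) with
    (elmul p (elpow p (eladd a b) k) (elmul p (elpow p a 0) (elpow p b 0))) by (simpl; ring).
  apply Hbinomial.
Qed.

Lemma almost_integral_IZR (z : Z) : almost_integral (El (IZR z) 0 0 0).
Proof.
  exists 1%Z; split; [lia|]; intros k; rewrite elpow_rational, pow_IZR.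
  repeat split; simpl; auto with isz.
Qed.

Lemma almost_integral_rational_isZ (t : R) : almost_integral (El t 0 0 0) -> isZ t.
Proof.
  intros Ht; destruct (base_Int_part t) as [B1 B2].
  assert (Hf : almost_integral (El (t - IZR (Int_part t)) 0 0 0)).
  { replace (El _ 0 0 0) with (eladd (El t 0 0 0) (El (IZR (- Int_part t)) 0 0 0))
      by (rewrite opp_IZR; el_ring).
    apply almost_integral_add; [assumption|apply almost_integral_IZR]. }
  destruct Hf as (N&HN&HL).
  exists (Int_part t); apply Rminus_diag_uniq.
  apply pow_bounded_denominator_zero with N; [assumption|lra|].
  intros k; specialize (HL k); rewrite elpow_rational in HL; apply HL.
Qed.

End AlmostIntegral.

Lemma sqfree_sqrt_integral (q : Z) (t : R) :
  Zsqfree q -> isQ t -> isZ (IZR q * (t * t)) -> isZ t.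
Proof.
  intros Hq Ht (k&Hk); destruct (isQ_lowest_terms t Ht) as (a&b&Hb&Hab&->).
  assert (Hb0 : IZR b <> 0) by now apply not_0_IZR.
  assert (Hqk : (q * (a * a) = k * (b * b))%Z).
  { apply eq_IZR; rewrite !mult_IZR, <- Hk; now field. }
  assert (Hdiv : (b * b | q)%Z).
  { apply Gauss with (a * a)%Z; [exists k; lia|].
    apply rel_prime_mult; apply rel_prime_sym, rel_prime_mult; assumption. }
  apply Hq in Hdiv; assert (b = 1 \/ b = -1)%Z as [-> | ->] by lia.
  - exists a; field.
  - exists (- a)%Z; rewrite opp_IZR; field.
Qed.

Lemma sqfree_5 : Zsqfree 5.
Proof.
  intros d (k&Hk).
  assert (Hk0 : (0 < k)%Z) by nia.
  assert (Hd2 : (d * d <= 5)%Z) by nia.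
  assert (Hd : (-3 < d < 3)%Z) by nia.
  assert (d = -2 \/ d = -1 \/ d = 0 \/ d = 1 \/ d = 2)%Z as [->|[->|[->|[->| ->]]]] by lia; lia.
Qed.

Lemma sum_squares_div4 (m k : Z) : (4 | m * m + k * k)%Z -> (2 | m)%Z /\ (2 | k)%Z.
Proof.
  intros (q&Hq).
  destruct (Z.Even_or_Odd m) as [[a ->]|[a ->]], (Z.Even_or_Odd k) as [[b ->]|[b ->]];
    [split; [exists a|exists b]; lia|exfalso; lia..].
Qed.

Lemma sqrt5_integer_parity (m k : Z) : (4 | m * m - 5 * (k * k))%Z -> (2 | m - k)%Z.
Proof.
  intros (q&Hq).
  destruct (Z.Even_or_Odd m) as [[a ->]|[a ->]], (Z.Even_or_Odd k) as [[b ->]|[b ->]];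
    [exists (a - b)%Z; lia|exfalso; lia..|exists (a - b)%Z; lia].
Qed.

Lemma quadratic_integer_coords (D : Z) (s t : R) :
  Zsqfree D -> isQ t -> isZ (2 * s) -> isZ (s * s - IZR D * (t * t)) ->
  exists A B : Z, 2 * s = IZR A /\ 2 * t = IZR B /\ (4 | A * A - D * (B * B))%Z.
Proof.
  intros HD Ht (A&HA) (N&HN).
  assert (H2t : isZ (2 * t)).
  { apply (sqfree_sqrt_integral D); [assumption|apply isQ_mul; [apply (isQ_IZR 2)|assumption]|].
    exists (A * A - 4 * N)%Z; rewrite minus_IZR, !mult_IZR, <- HA, <- HN; ring. }
  destruct H2t as (B&HB); exists A, B; split; [assumption|split; [assumption|]].
  exists N; apply eq_IZR; rewrite minus_IZR, !mult_IZR, <- HA, <- HB, <- HN; ring.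
Qed.

Section IntegerRing.
Variable p : Z.

Lemma almost_integral_quadratic (D : Z) (s t : bool) (u v : R) (a : el) :
  Zsqfree D -> isQ v -> almost_integral p a ->
  eladd a (elconj s t a) = El (2 * u) 0 0 0 ->
  elmul p a (elconj s t a) = El (u * u - IZR D * (v * v)) 0 0 0 ->
  exists A B : Z, 2 * u = IZR A /\ 2 * v = IZR B /\ (4 | A * A - D * (B * B))%Z.
Proof.
  intros HD Hv Ha Htrace Hnorm.
  pose proof (almost_integral_conj p s t a Ha).
  apply quadratic_integer_coords; [assumption..| |]; apply (almost_integral_rational_isZ p).
  - rewrite <- Htrace; now apply almost_integral_add.
  - rewrite <- Hnorm; now apply almost_integral_mul.
Qed.

Hypothesis p_sqfree : Zsqfree p.
Hypothesis r_sqfree : Zsqfree (5 * p).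
Hypothesis p_mod4 : (exists k, p = 4 * k + 3)%Z.

Lemma in_OK_half_integral (a b c d : R) : in_OK p (El a b c d) ->
  exists A B C D : Z, a = IZR A / 2 /\ b = IZR B / 2 /\ c = IZR C / 2 /\ d = IZR D / 2.
Proof.
  intros Ha; pose proof (in_OK_almost_integral p _ Ha); destruct Ha as ((_&Qb&Qc&Qd)&_).
  set (al := El a b c d) in *; simpl in Qb, Qc, Qd.
  assert (Hdouble : forall t, isQ t -> isQ (2 * t))
    by (intros; apply isQ_mul; [apply (isQ_IZR 2)|assumption]).
  assert (Htrace : forall s t, almost_integral p (eladd al (elconj s t al)))
    by (intros; apply almost_integral_add; [|apply almost_integral_conj]; assumption).
  (* the traces of [al] to the three quadratic subfields *)
  destruct (almost_integral_quadratic 5 false true (2 * a) (2 * b)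
    (eladd al (elconj true false al))) as (A&B&HA&HB&HAB);
    [apply sqfree_5|auto|apply Htrace|el_ring|el_ring|].
  destruct (almost_integral_quadratic p true false (2 * a) (2 * c)
    (eladd al (elconj false true al))) as (A'&C&HA'&HC&HAC);
    [assumption|auto|apply Htrace|el_ring|el_ring|].
  destruct (almost_integral_quadratic (5 * p) true false (2 * a) (2 * d)
    (eladd al (elconj false false al))) as (A''&D&HA''&HD&HAD);
    [assumption|auto|apply Htrace|el_ring|rewrite mult_IZR; el_ring|].
  assert (A' = A) by (apply eq_IZR; congruence); assert (A'' = A) by (apply eq_IZR; congruence).
  subst A' A''; destruct p_mod4 as (k&Hk).
  destruct (sum_squares_div4 A C) as [[a' Ea] [c' Ec]].
  { destruct HAC as (q&Hq); exists (q + (k + 1) * (C * C))%Z; subst p; lia. }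
  destruct (sum_squares_div4 0 B) as [_ [b' Eb]].
  { destruct HAB as (q&Hq); exists (a' * a' - q - B * B)%Z; subst A; lia. }
  destruct (sum_squares_div4 A D) as [_ [d' Ed]].
  { destruct HAD as (q&Hq); exists (q + (5 * k + 4) * (D * D))%Z; subst p; lia. }
  exists a', b', c', d'; subst A B C D; rewrite mult_IZR in HA, HB, HC, HD; lra.
Qed.

(* [x + y phi + (z + t phi) sqrt p], where [phi] is the golden ratio *)
Definition golden_el (x y z t : Z) : el :=
  El (IZR x + IZR y / 2) (IZR y / 2) (IZR z + IZR t / 2) (IZR t / 2).

Lemma in_OK_golden_el (x y z t : Z) : in_OK p (golden_el x y z t).
Proof.
  split.
  - repeat split; simpl; [exists (2 * x + y)%Z | exists y | exists (2 * z + t)%Z | exists t];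
      exists 2%Z; (split; [lia|rewrite ?plus_IZR, ?mult_IZR; field]).
  - (* the norm to Q of T^2 - 2 u T + (u^2 - p v^2), with u = x + y phi, v = z + t phi and
       u^2 - p v^2 = n0 + n1 phi *)
    set (n0 := (x * x + y * y - p * (z * z + t * t))%Z).
    set (n1 := (2 * x * y + y * y - p * (2 * z * t + t * t))%Z).
    exists 4%nat, (fun k => match k with
      | 0%nat => n0 * n0 + n0 * n1 - n1 * n1
      | 1%nat => - (4 * x * n0 + 2 * x * n1 + 2 * y * n0 - 4 * y * n1)
      | 2%nat => 2 * n0 + n1 + 4 * (x * x + x * y - y * y)
      | _ => - (4 * x + 2 * y) end)%Z.
    cbn [polyval]; unfold n0, n1; repeat rewrite ?plus_IZR, ?minus_IZR, ?opp_IZR, ?mult_IZR.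
    unfold golden_el; set (y' := IZR y / 2); set (t' := IZR t / 2).
    replace (IZR y) with (2 * y') by (unfold y'; field).
    replace (IZR t) with (2 * t') by (unfold t'; field).
    apply el_ext; cbv [elpow elmul eladd elscale el0 el1 e0 e1 e2 e3]; ring.
Qed.

Lemma in_OK_is_golden_el (a : el) : in_OK p a -> exists x y z t, a = golden_el x y z t.
Proof.
  intros Ha; assert (Hal := in_OK_almost_integral p _ Ha).
  destruct a as [a b c d].
  destruct (in_OK_half_integral a b c d Ha) as (A&B&C&D&->&->&->&->); clear Ha.
  destruct p_mod4 as (k&Hk).
  set (al := El _ _ _ _) in Hal |- *.
  set (u := IZR (A * A + 5 * (B * B) - p * (C * C + 5 * (D * D))) / 4).
  set (v := IZR (A * B - p * (C * D)) / 2).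
  assert (Hnorm : elmul p al (elconj true false al) = El u v 0 0).
  { apply el_ext; unfold al, u, v; cbv [elmul elconj e0 e1 e2 e3 sg];
      rewrite ?minus_IZR, ?plus_IZR, ?mult_IZR, ?plus_IZR, ?mult_IZR; field. }
  destruct (almost_integral_quadratic 5 false true u v (El u v 0 0))
    as (N0&N1&HN0&HN1&(q&Hq)); [apply sqfree_5| | |el_ring|el_ring|].
  - exists (A * B - p * (C * D))%Z, 2%Z; split; [lia|reflexivity].
  - rewrite <- Hnorm; apply almost_integral_mul; [|apply almost_integral_conj]; assumption.
  - assert (EN1 : N1 = (A * B - p * (C * D))%Z) by (apply eq_IZR; unfold v in HN1; lra).
    assert (EN0 : (2 * N0 = A * A + 5 * (B * B) - p * (C * C + 5 * (D * D)))%Z)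
      by (apply eq_IZR; rewrite mult_IZR; unfold u in HN0; lra).
    destruct (sqrt5_integer_parity N0 N1) as (j&Hj); [now exists q|].
    destruct (sum_squares_div4 (A - B) (C - D)) as [[s Es] [t Et]].
    { exists (j - B * B + p * (D * D) + (k + 1) * (C * C + D * D - 2 * (C * D)))%Z.
      subst p; lia. }
    exists s, B, t, D; unfold al.
    replace A with (s * 2 + B)%Z by lia; replace C with (t * 2 + D)%Z by lia.
    apply el_ext; cbv [golden_el e0 e1 e2 e3]; rewrite ?plus_IZR, ?mult_IZR; field.
Qed.

End IntegerRing.

(** * Logarithms and cones in the real plane *)

Lemma ln_le_iff (x y : R) : 0 < x -> 0 < y -> (ln x <= ln y <-> x <= y).
Proof.
  intros Hx Hy; split; intros [H|H].
  - left; now apply ln_lt_inv.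
  - right; now apply ln_inv.
  - left; now apply ln_increasing.
  - right; now rewrite H.
Qed.

Lemma ln_powerRZ (x : R) (k : Z) : 0 < x -> ln (powerRZ x k) = IZR k * ln x.
Proof. intros Hx; rewrite powerRZ_Rpower by assumption; apply ln_exp. Qed.

Lemma floor_multiple (c x : R) : 0 < c -> exists k : Z, IZR k * c <= x < (IZR k + 1) * c.
Proof.
  intros Hc; exists (Int_part (x / c)); destruct (base_Int_part (x / c)) as [B1 B2].
  assert (Hx : x = x / c * c) by (field; lra).
  set (k := IZR (Int_part (x / c))) in *; set (r := x / c) in *; rewrite Hx; nra.
Qed.

Lemma affine_pos_between (l m w w' x : R) :
  (x - w) * (x - w') < 0 -> 0 < l + m * w -> 0 < l + m * w' -> 0 < l + m * x.
Proof. intros; nra. Qed.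

(* In logarithmic coordinates the cone spanned by [(1, 1)] and [(w, 1/w)] is the strip
   [0 <= ln x - ln y <= 2 ln w]. *)
Lemma plane_cone_of_log_strip (w w' x y : R) :
  0 < w -> 0 < w' -> 0 < x -> 0 < y ->
  0 < ln w -> ln w' = - ln w -> 0 <= ln x - ln y <= 2 * ln w ->
  exists l m, 0 <= l /\ 0 <= m /\ x = l + m * w /\ y = l + m * w'.
Proof.
  intros Hw Hw' Hx Hy Hln Hln' [H1 H2].
  assert (Hww' : w * w' = 1) by (apply ln_inv; [nra|lra|rewrite ln_mult, ln_1; lra]).
  assert (Hw1 : 1 < w) by (apply ln_lt_inv; rewrite ?ln_1; lra).
  assert (Hyx : y <= x) by (apply ln_le_iff; lra).
  assert (Hxy : x * w' <= y * w).
  { pose proof (Rmult_lt_0_compat _ _ Hw Hw).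
    assert (x <= y * (w * w)) by (apply ln_le_iff; [assumption|nra|rewrite !ln_mult; lra]).
    replace (y * w) with (y * (w * w) * w') by ring [Hww'].
    apply Rmult_le_compat_r; nra. }
  assert (Hd : 0 < w - w') by nra.
  exists ((y * w - x * w') / (w - w')), ((x - y) / (w - w')).
  split; [apply Rle_mult_inv_pos; lra|split; [apply Rle_mult_inv_pos; lra|]].
  split; field; lra.
Qed.

(* [k], [l] range over the translations by the lattice spanned by [(E, E)] and [(G, - G)]. *)
Lemma lattice_cover (E G t1 t2 : R) :
  0 < E -> E <= G -> exists k l : Z,
  let u1 := t1 + IZR k * E + IZR l * G in
  let u2 := t2 + IZR k * E - IZR l * G in
  (0 <= u1 <= E /\ 0 <= u2 <= E) \/ (0 <= u1 <= G /\ - G <= u2 <= 0).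
Proof.
  intros HE HG.
  assert (Hfl : forall c t, 0 < c -> exists k : Z, 0 <= t + IZR k * c < c).
  { intros c t Hc; destruct (floor_multiple c t Hc) as (k&Hk).
    exists (- k)%Z; rewrite opp_IZR; lra. }
  destruct (Hfl (2 * G) (t1 - t2 + G)) as (l&Hl); [lra|].
  destruct (Rle_dec 0 (t1 + IZR l * G - (t2 - IZR l * G))) as [H|H].
  - destruct (Hfl E (t1 + IZR l * G) HE) as (k&Hk).
    exists k, l; simpl.
    destruct (Rle_dec 0 (t2 + IZR k * E - IZR l * G)); [left|right]; lra.
  - destruct (Hfl E (t2 - IZR l * G) HE) as (k&Hk).
    destruct (Rle_dec 0 (t1 + IZR k * E + IZR l * G)).
    + exists k, l; simpl; left; lra.
    + exists k, (l + 1)%Z; rewrite plus_IZR; simpl; right; lra.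
Qed.

(** * The ring [Z[phi]] at its two real places *)

(* The place [true] sends [sqrt 5] to [sqrt 5] and the place [false] sends it to [- sqrt 5]; an
   element of [Q(sqrt 5)] is represented by the family of its two real values. *)
Definition root5 (s : bool) : R := sg s * sqrt 5.
Definition phi (s : bool) : R := (1 + root5 s) / 2.

Lemma sqrt5_bounds : 2.236 < sqrt 5 < 2.2361.
Proof.
  assert (Hsq : sqrt 5 * sqrt 5 = 5) by (apply sqrt_sqrt; lra).
  assert (0 <= sqrt 5) by apply sqrt_pos; split; nra.
Qed.

Lemma root5_true : root5 true = sqrt 5.
Proof. unfold root5; simpl; ring. Qed.

Lemma root5_negb (s : bool) : root5 (negb s) = - root5 s.
Proof. unfold root5; destruct s; simpl; ring. Qed.

Lemma root5_false : root5 false = - sqrt 5.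
Proof. unfold root5; simpl; ring. Qed.

Lemma root5_sq (s : bool) : root5 s * root5 s = 5.
Proof.
  assert (Hsq : sqrt 5 * sqrt 5 = 5) by (apply sqrt_sqrt; lra).
  unfold root5; destruct s; simpl; ring [Hsq].
Qed.

Lemma root5_neq_0 (s : bool) : root5 s <> 0.
Proof. intros Hroot5; assert (Hsq := root5_sq s); rewrite Hroot5 in Hsq; lra. Qed.

Lemma root5_phi (s : bool) : root5 s = 2 * phi s - 1.
Proof. unfold phi; field. Qed.

Lemma phi_sq (s : bool) : phi s * phi s = phi s + 1.
Proof. unfold phi; pose proof (root5_sq s); lra. Qed.

Lemma phi_neq_0 (s : bool) : phi s <> 0.
Proof. intros Hphi; assert (Hsq := phi_sq s); rewrite Hphi in Hsq; lra. Qed.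

Lemma phi_negb (s : bool) : phi (negb s) = 1 - phi s.
Proof. unfold phi; rewrite root5_negb; field. Qed.

Lemma phi_false : phi false = 1 - phi true.
Proof. apply (phi_negb true). Qed.

Lemma phi_norm (s : bool) : phi s * phi (negb s) = -1.
Proof. rewrite phi_negb; ring [(phi_sq s)]. Qed.

Lemma phi_inv (s : bool) : / phi s = phi s - 1.
Proof.
  apply Rmult_eq_reg_l with (phi s); [|apply phi_neq_0].
  rewrite Rinv_r by apply phi_neq_0; ring [(phi_sq s)].
Qed.

Lemma phi_true_bounds : 1.618 < phi true < 1.61805.
Proof. unfold phi; rewrite root5_true; pose proof sqrt5_bounds; lra. Qed.

Lemma phi_false_bounds : -0.61805 < phi false < -0.618.
Proof. rewrite phi_false; pose proof phi_true_bounds; lra. Qed.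

Definition in_Zphi (z : bool -> R) : Prop :=
  exists a b : Z, forall s, z s = IZR a + IZR b * phi s.

Lemma in_Zphi_ext (z w : bool -> R) : (forall s, z s = w s) -> in_Zphi w -> in_Zphi z.
Proof. intros E (a&b&H); exists a, b; intros s; now rewrite E. Qed.

Lemma in_Zphi_add (z w : bool -> R) : in_Zphi z -> in_Zphi w -> in_Zphi (fun s => z s + w s).
Proof.
  intros (a&b&Hz) (c&d&Hw); exists (a + c)%Z, (b + d)%Z; intros s.
  rewrite Hz, Hw, !plus_IZR; ring.
Qed.

Lemma in_Zphi_opp (z : bool -> R) : in_Zphi z -> in_Zphi (fun s => - z s).
Proof. intros (a&b&Hz); exists (- a)%Z, (- b)%Z; intros s; rewrite Hz, !opp_IZR; ring. Qed.

Lemma in_Zphi_sub (z w : bool -> R) : in_Zphi z -> in_Zphi w -> in_Zphi (fun s => z s - w s).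
Proof. intros Hz Hw; apply in_Zphi_add; [|apply in_Zphi_opp]; assumption. Qed.

Lemma in_Zphi_mul (z w : bool -> R) : in_Zphi z -> in_Zphi w -> in_Zphi (fun s => z s * w s).
Proof.
  intros (a&b&Hz) (c&d&Hw); exists (a * c + b * d)%Z, (a * d + b * c + b * d)%Z; intros s.
  rewrite Hz, Hw, !plus_IZR, !mult_IZR; ring [(phi_sq s)].
Qed.

Lemma in_Zphi_IZR (k : Z) : in_Zphi (fun _ => IZR k).
Proof. exists k, 0%Z; intros s; ring. Qed.

Lemma in_Zphi_phi : in_Zphi phi.
Proof. exists 0%Z, 1%Z; intros s; ring. Qed.

Lemma in_Zphi_root5 : in_Zphi root5.
Proof. exists (-1)%Z, 2%Z; intros s; rewrite root5_phi; ring. Qed.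

#[local] Hint Resolve in_Zphi_add in_Zphi_opp in_Zphi_sub in_Zphi_mul in_Zphi_IZR
  in_Zphi_phi in_Zphi_root5 : zphi.

Lemma in_Zphi_norm_isZ (z : bool -> R) : in_Zphi z -> isZ (z true * z false).
Proof.
  intros (a&b&Hz); exists (a * a + a * b - b * b)%Z.
  rewrite !Hz, minus_IZR, plus_IZR, !mult_IZR.
  rewrite phi_false; ring [(phi_sq true)].
Qed.

(* [Z[phi] / sqrt 5] is the dual of [Z[phi]] for the trace form. *)
Lemma in_Zphi_trace_isZ (z : bool -> R) :
  in_Zphi z -> isZ (z true / root5 true + z false / root5 false).
Proof.
  intros (a&b&Hz); exists b; rewrite !Hz; change false with (negb true).
  unfold phi; rewrite root5_negb; field; apply root5_neq_0.
Qed.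

Lemma root5_irrational (s : bool) : ~ isQ (root5 s).
Proof.
  intros H; destruct (sqfree_sqrt_integral 5 (root5 s)) as (k&Hk); [apply sqfree_5|assumption| |].
  - exists 25%Z; rewrite root5_sq; ring.
  - assert (Hk5 : (k * k = 5)%Z)
      by (apply eq_IZR; rewrite mult_IZR, <- Hk; apply root5_sq).
    assert (Hk1 : Z.abs k = 1%Z) by (apply sqfree_5; exists 1%Z; lia).
    nia.
Qed.

Lemma in_Zphi_zero (z : bool -> R) (s : bool) : in_Zphi z -> z s = 0 -> forall s', z s' = 0.
Proof.
  intros (a&b&Hz) H0; rewrite Hz in H0.
  destruct (Z.eq_dec b 0) as [->|Hb].
  - intros s'; rewrite Hz; lra.
  - exfalso; apply (root5_irrational s); exists (- (2 * a + b))%Z, b; split; [assumption|].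
    apply not_0_IZR in Hb; rewrite opp_IZR, plus_IZR, mult_IZR.
    apply Rmult_eq_reg_r with (IZR b); [|assumption]; unfold phi in H0; field_simplify; lra.
Qed.

Definition phi_pow (s : bool) (k : Z) : R := powerRZ (phi s) k.

Lemma phi_pow_0 (s : bool) : phi_pow s 0 = 1.
Proof. reflexivity. Qed.

Lemma phi_pow_1 (s : bool) : phi_pow s 1 = phi s.
Proof. apply powerRZ_1. Qed.

Lemma phi_pow_add (s : bool) (i j : Z) : phi_pow s (i + j) = phi_pow s i * phi_pow s j.
Proof. apply powerRZ_add, phi_neq_0. Qed.

Lemma phi_pow_neq_0 (s : bool) (k : Z) : phi_pow s k <> 0.
Proof. apply powerRZ_NOR, phi_neq_0. Qed.

Lemma phi_pow_opp_r (s : bool) (k : Z) : phi_pow s k * phi_pow s (- k) = 1.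
Proof. rewrite <- phi_pow_add, Z.add_opp_diag_r; apply phi_pow_0. Qed.

Lemma phi_pow_2 (s : bool) : phi_pow s 2 = phi s + 1.
Proof. change 2%Z with (1 + 1)%Z; rewrite phi_pow_add, phi_pow_1; apply phi_sq. Qed.

Lemma phi_pow_m1 (s : bool) : phi_pow s (-1) = phi s - 1.
Proof. rewrite <- phi_inv; unfold phi_pow; simpl; f_equal; ring. Qed.

Lemma phi_pow_4 (s : bool) : phi_pow s 4 = 3 * phi s + 2.
Proof. change 4%Z with (2 + 2)%Z; rewrite phi_pow_add, phi_pow_2; ring [(phi_sq s)]. Qed.

Lemma phi_pow_negb (s : bool) (k : Z) : phi_pow (negb s) k = powerRZ (-1) k * phi_pow s (- k).
Proof.
  apply Rmult_eq_reg_r with (phi_pow s k); [|apply phi_pow_neq_0].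
  rewrite Rmult_assoc, (Rmult_comm (phi_pow s (- k))), phi_pow_opp_r, <- (phi_norm s).
  unfold phi_pow; rewrite powerRZ_mult; ring.
Qed.

Lemma phi_pow_negb_even (s : bool) (k : Z) : phi_pow (negb s) (2 * k) = phi_pow s (- (2 * k)).
Proof.
  rewrite phi_pow_negb; replace (2 * k)%Z with (k + k)%Z at 1 by lia.
  rewrite powerRZ_add, <- powerRZ_mult by lra.
  replace (-1 * -1) with 1 by ring; rewrite powerRZ_R1; ring.
Qed.

Lemma phi_pow_negb_odd (s : bool) (k : Z) :
  phi_pow (negb s) (2 * k + 1) = - phi_pow s (- (2 * k + 1)).
Proof.
  rewrite phi_pow_add, phi_pow_negb_even, phi_pow_1, phi_negb.
  replace (- (2 * k + 1))%Z with (- (2 * k) + -1)%Z by lia; rewrite phi_pow_add, phi_pow_m1; ring.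
Qed.

Lemma phi_pow_false_even (k : Z) : phi_pow false (2 * k) = phi_pow true (- (2 * k)).
Proof. apply (phi_pow_negb_even true). Qed.

Lemma phi_pow_false_4 (k : Z) : phi_pow false (4 * k) = phi_pow true (- (4 * k)).
Proof. replace (4 * k)%Z with (2 * (2 * k))%Z by lia; apply phi_pow_false_even. Qed.

Lemma phi_pow_even_pos (s : bool) (k : Z) : 0 < phi_pow s (2 * k).
Proof.
  replace (2 * k)%Z with (k + k)%Z by lia; rewrite phi_pow_add.
  pose proof (phi_pow_neq_0 s k); nra.
Qed.

Lemma phi_pow_true_pos (k : Z) : 0 < phi_pow true k.
Proof. apply powerRZ_lt; pose proof phi_true_bounds; lra. Qed.

Lemma phi_pow_true_lt (i j : Z) : (i < j)%Z -> phi_pow true i < phi_pow true j.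
Proof.
  intros H; pose proof phi_true_bounds; unfold phi_pow.
  rewrite !powerRZ_Rpower by lra; apply Rpower_lt; [lra|now apply IZR_lt].
Qed.

Lemma phi_pow_true_le (i j : Z) : (i <= j)%Z -> phi_pow true i <= phi_pow true j.
Proof.
  intros H; destruct (Z.eq_dec i j) as [->|]; [lra|].
  left; apply phi_pow_true_lt; lia.
Qed.

Lemma phi_pow_true_lt_1 (k : Z) : (k < 0)%Z -> phi_pow true k < 1.
Proof. rewrite <- (phi_pow_0 true); apply phi_pow_true_lt. Qed.

Lemma phi_pow_true_inj (i j : Z) : phi_pow true i = phi_pow true j -> i = j.
Proof.
  intros H; destruct (Z.lt_trichotomy i j) as [L|[L|L]]; [|assumption|];
    apply phi_pow_true_lt in L; lra.
Qed.

Lemma ln_phi_pos : 0 < ln (phi true).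
Proof. pose proof phi_true_bounds; rewrite <- ln_1; apply ln_increasing; lra. Qed.

Lemma ln_phi_pow (k : Z) : ln (phi_pow true k) = IZR k * ln (phi true).
Proof. apply ln_powerRZ; pose proof phi_true_bounds; lra. Qed.

Lemma in_Zphi_phi_pow (k : Z) : in_Zphi (fun s => phi_pow s k).
Proof.
  induction k as [|k IH|k IH] using Z.peano_ind.
  - apply (in_Zphi_IZR 1).
  - apply in_Zphi_ext with (fun s => phi_pow s k * phi s); [|auto with zphi].
    intros s; rewrite <- Z.add_1_r, phi_pow_add, phi_pow_1; reflexivity.
  - apply in_Zphi_ext with (fun s => phi_pow s k * (phi s - 1)); [|auto with zphi].
    intros s; rewrite <- Z.sub_1_r, <- phi_pow_m1, <- phi_pow_add; reflexivity.
Qed.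

#[local] Hint Resolve in_Zphi_phi_pow : zphi.

Lemma phi_pow_balance (x y : R) : 0 < x -> 0 < y -> exists k : Z,
  phi_pow true (2 * k) * y <= phi_pow true (- (2 * k)) * x <
    phi_pow true 4 * (phi_pow true (2 * k) * y).
Proof.
  intros Hx Hy; pose proof ln_phi_pos.
  destruct (floor_multiple (4 * ln (phi true)) (ln x - ln y)) as (k&Hk1&Hk2); [lra|].
  assert (Hpos := phi_pow_true_pos (2 * k)); assert (Hpos' := phi_pow_true_pos (- (2 * k))).
  pose proof (phi_pow_true_pos 4).
  pose proof (Rmult_lt_0_compat _ _ Hpos' Hx); pose proof (Rmult_lt_0_compat _ _ Hpos Hy).
  exists k; split; [apply ln_le_iff; [assumption..|]|apply ln_lt_inv; [nra..|]];
    rewrite !ln_mult, !ln_phi_pow, ?opp_IZR, ?mult_IZR by assumption; lra.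
Qed.

(* Up to the square of a unit, the quotient of the two real values of [z] lies between [1] and
   [phi^4]; this forces nonnegative coordinates in the basis [1], [phi^2]. *)
Lemma in_Zphi_pos_decomposition (z : bool -> R) :
  in_Zphi z -> (forall s, 0 < z s) ->
  exists k a b : Z, (1 <= a)%Z /\ (0 <= b)%Z /\
    forall s, z s = phi_pow s (2 * k) * (IZR a + IZR b * phi_pow s 2).
Proof.
  intros Hz Hpos.
  destruct (phi_pow_balance (z true) (z false)) as (k&Hk1&Hk2); [apply Hpos..|].
  assert (Hw : in_Zphi (fun s => phi_pow s (- (2 * k)) * z s)) by auto with zphi.
  destruct Hw as (a&b&Hw).
  assert (Hcoords : forall s, phi_pow s (- (2 * k)) * z s = IZR (a - b) + IZR b * phi_pow s 2)
    by (intros s; rewrite Hw, phi_pow_2, minus_IZR; ring).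
  replace (phi_pow true (2 * k)) with (phi_pow false (- (2 * k))) in Hk1, Hk2.
  2:{ replace (- (2 * k))%Z with (2 * - k)%Z by lia; rewrite phi_pow_false_even; f_equal; lia. }
  exists k, (a - b)%Z, b.
  rewrite !Hcoords in Hk1, Hk2.
  pose proof phi_true_bounds; pose proof phi_false_bounds.
  assert (Hphi2 := phi_pow_2 true); assert (Hphi2' := phi_pow_2 false).
  assert (Hphi4 := phi_pow_4 true).
  assert (Hphi42 : phi_pow true 4 * phi_pow false 2 = phi_pow true 2).
  { rewrite Hphi4, Hphi2, Hphi2'; rewrite phi_false; ring [(phi_sq true)]. }
  assert (Hb : 0 <= IZR b) by nra.
  assert (Ha : 0 < IZR (a - b)) by nra.
  apply lt_IZR in Ha; apply le_IZR in Hb; split; [lia|split; [assumption|]].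
  intros s; rewrite <- Hcoords, <- Rmult_assoc, phi_pow_opp_r; ring.
Qed.

Lemma in_Zphi_pos_norm (z : bool -> R) :
  in_Zphi z -> (forall s, 0 < z s) -> 1 <= z true * z false.
Proof.
  intros Hz Hpos; apply isZ_pos_ge_1; [now apply in_Zphi_norm_isZ|].
  apply Rmult_lt_0_compat; apply Hpos.
Qed.

Lemma in_Zphi_two_units_below (z : bool -> R) :
  in_Zphi z -> (forall s, 0 < z s) ->
  exists k, (forall s, phi_pow s (2 * k) <= z s) /\
    ((forall s, phi_pow s (2 * (k + 1)) <= z s) \/
     exists c : Z, (1 <= c <= 2)%Z /\ forall s, z s = IZR c * phi_pow s (2 * k)).
Proof.
  intros Hz Hpos; destruct (in_Zphi_pos_decomposition z Hz Hpos) as (k&a&b&Ha&Hb&E).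
  pose proof (IZR_le _ _ Ha); pose proof (IZR_le _ _ Hb).
  assert (Hphi2 : forall s, 0 < phi_pow s 2 <= 3).
  { pose proof phi_true_bounds; pose proof phi_false_bounds.
    intros []; rewrite phi_pow_2; lra. }
  exists k; split.
  - intros s; rewrite E; pose proof (phi_pow_even_pos s k); specialize (Hphi2 s).
    rewrite <- (Rmult_1_r (phi_pow s (2 * k))) at 1; apply Rmult_le_compat_l; nra.
  - assert (Hc : (b = 0 /\ a <= 2)%Z \/ (1 <= b)%Z \/ (3 <= a)%Z) by lia.
    destruct Hc as [[-> Hc]|Hc].
    + right; exists a; split; [lia|]; intros s; rewrite E; ring.
    + left; intros s; rewrite E; replace (2 * (k + 1))%Z with (2 * k + 2)%Z by lia.
      rewrite phi_pow_add; apply Rmult_le_compat_l; [left; apply phi_pow_even_pos|].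
      specialize (Hphi2 s); destruct Hc as [Hc|Hc]; apply IZR_le in Hc; nra.
Qed.

Lemma in_Zphi_unit_below (z : bool -> R) :
  in_Zphi z -> (forall s, 0 < z s) -> exists k, forall s, phi_pow s (2 * k) <= z s.
Proof.
  intros Hz Hpos; destruct (in_Zphi_two_units_below z Hz Hpos) as (k&Hk&_); now exists k.
Qed.

Lemma root5_multiple_sign (l : bool -> R) :
  in_Zphi (fun s => root5 s * l s) -> (forall s, 0 <= l s) ->
  (forall s, l s = 0) \/ (forall s, 0 < l s).
Proof.
  intros Hl Hpos.
  assert (Hzero : forall s, l s = 0 -> forall s', l s' = 0).
  { intros s Hs s'; apply Rmult_eq_reg_l with (root5 s'); [|apply root5_neq_0].
    rewrite Rmult_0_r; apply (in_Zphi_zero _ s Hl); rewrite Hs; ring. }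
  destruct (Req_dec (l true) 0) as [E|E]; [left; now apply Hzero with true|right].
  intros s; destruct (Hpos s) as [Hs|Hs]; [assumption|].
  exfalso; apply E; apply Hzero with s; now symmetry.
Qed.

(* [tau] generates [Z[phi] / sqrt 5] and is totally positive. *)
Definition tau (s : bool) : R := / (root5 s * phi s).

Lemma root5_mul_phi (s : bool) : root5 s * phi s = phi s + 2.
Proof. rewrite root5_phi; ring [(phi_sq s)]. Qed.

Lemma root5_mul_phi_neq_0 (s : bool) : root5 s * phi s <> 0.
Proof. apply Rmult_integral_contrapositive; split; [apply root5_neq_0|apply phi_neq_0]. Qed.

Lemma tau_pos (s : bool) : 0 < tau s.
Proof.
  unfold tau; apply Rinv_0_lt_compat; rewrite root5_mul_phi.
  pose proof phi_true_bounds; pose proof phi_false_bounds; destruct s; lra.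
Qed.

Lemma tau_norm : tau true * tau false = / 5.
Proof.
  unfold tau; rewrite <- Rinv_mult, !root5_mul_phi; f_equal.
  rewrite phi_false; ring [(phi_sq true)].
Qed.

Lemma div_tau (z : R) (s : bool) : z = tau s * (root5 s * phi s * z).
Proof. unfold tau; field; auto using root5_neq_0, phi_neq_0. Qed.

Lemma root5_tau (s : bool) : root5 s * tau s = phi_pow s (-1).
Proof.
  rewrite phi_pow_m1, <- phi_inv; unfold tau; field; auto using root5_neq_0, phi_neq_0.
Qed.

Lemma in_Zphi_root5_tau (z : bool -> R) : in_Zphi z -> in_Zphi (fun s => root5 s * (tau s * z s)).
Proof.
  intros Hz; apply in_Zphi_ext with (fun s => phi_pow s (-1) * z s); [|auto with zphi].
  intros s; rewrite <- root5_tau; ring.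
Qed.

Lemma phi_div_root5_pos (s : bool) : 0 < phi s / root5 s.
Proof.
  replace (phi s / root5 s) with (phi s * phi s * tau s)
    by (unfold tau; field; auto using root5_neq_0, phi_neq_0).
  apply Rmult_lt_0_compat; [|apply tau_pos]; pose proof (phi_neq_0 s); nra.
Qed.

Definition cong_root5 (z : bool -> R) (c : Z) : Prop := in_Zphi (fun s => (z s - IZR c) / root5 s).

Lemma cong_root5_ext (z w : bool -> R) (c : Z) :
  (forall s, z s = w s) -> cong_root5 w c -> cong_root5 z c.
Proof. intros E; apply in_Zphi_ext; intros s; now rewrite E. Qed.

Lemma cong_root5_in_Zphi (z : bool -> R) (c : Z) : cong_root5 z c -> in_Zphi z.
Proof.
  intros H; apply in_Zphi_ext with (fun s => root5 s * ((z s - IZR c) / root5 s) + IZR c).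
  - intros s; field; apply root5_neq_0.
  - auto with zphi.
Qed.

Lemma cong_root5_IZR (c : Z) : cong_root5 (fun _ => IZR c) c.
Proof.
  apply in_Zphi_ext with (fun _ => IZR 0); [|apply in_Zphi_IZR].
  intros s; field; apply root5_neq_0.
Qed.

Lemma cong_root5_add (z w : bool -> R) (c d : Z) :
  cong_root5 z c -> cong_root5 w d -> cong_root5 (fun s => z s + w s) (c + d).
Proof.
  intros Hz Hw; apply in_Zphi_ext with
    (fun s => (z s - IZR c) / root5 s + (w s - IZR d) / root5 s); [|now apply in_Zphi_add].
  intros s; rewrite plus_IZR; field; apply root5_neq_0.
Qed.

Lemma cong_root5_mul (z w : bool -> R) (c d : Z) :
  cong_root5 z c -> cong_root5 w d -> cong_root5 (fun s => z s * w s) (c * d).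
Proof.
  intros Hz Hw; pose proof (cong_root5_in_Zphi w d Hw); apply in_Zphi_ext with
    (fun s => (z s - IZR c) / root5 s * w s + IZR c * ((w s - IZR d) / root5 s));
    [|auto with zphi].
  intros s; rewrite mult_IZR; field; apply root5_neq_0.
Qed.

Lemma cong_root5_trans (z w : bool -> R) (c : Z) :
  in_Zphi (fun s => (z s - w s) / root5 s) -> cong_root5 w c -> cong_root5 z c.
Proof.
  intros Hzw Hw; apply in_Zphi_ext with
    (fun s => (z s - w s) / root5 s + (w s - IZR c) / root5 s); [|now apply in_Zphi_add].
  intros s; field; apply root5_neq_0.
Qed.

Lemma cong_root5_mod5 (z : bool -> R) (c d : Z) :
  (5 | c - d)%Z -> cong_root5 z c -> cong_root5 z d.
Proof.
  intros (k&Hk) H; apply in_Zphi_ext with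
    (fun s => (z s - IZR c) / root5 s + IZR k * root5 s); [|auto with zphi].
  intros s; replace c with (d + k * 5)%Z by lia; rewrite plus_IZR, mult_IZR.
  field_simplify_eq; [ring [(root5_sq s)]|apply root5_neq_0].
Qed.

Lemma cong_root5_unique (z : bool -> R) (c d : Z) :
  cong_root5 z c -> cong_root5 z d -> (5 | c - d)%Z.
Proof.
  intros Hc Hd.
  destruct (in_Zphi_trace_isZ (fun s => (z s - IZR d) / root5 s - (z s - IZR c) / root5 s))
    as (k&Hk); [now apply in_Zphi_sub|].
  exists (c - d - 2 * k)%Z; assert (Hsq := root5_sq true); pose proof (root5_neq_0 true).
  cut (2 * (c - d) = 5 * k)%Z; [lia|].
  apply eq_IZR; rewrite !mult_IZR, minus_IZR, <- Hk.
  change false with (negb true); rewrite root5_negb.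
  field_simplify_eq; [ring [Hsq]|assumption].
Qed.

Lemma cong_root5_phi_pow_add (i j c d e : Z) :
  (5 | c * d - e)%Z -> cong_root5 (fun s => phi_pow s i) c -> cong_root5 (fun s => phi_pow s j) d ->
  cong_root5 (fun s => phi_pow s (i + j)) e.
Proof.
  intros He Hi Hj; apply cong_root5_mod5 with (c * d)%Z; [assumption|].
  apply cong_root5_ext with (fun s => phi_pow s i * phi_pow s j);
    [intros s; apply phi_pow_add|now apply cong_root5_mul].
Qed.

Lemma cong_root5_phi_pow_1 : cong_root5 (fun s => phi_pow s 1) 3.
Proof.
  apply in_Zphi_ext with (fun s => IZR 1 - phi s); [|auto with zphi].
  intros s; rewrite phi_pow_1; field_simplify_eq; [|apply root5_neq_0].
  rewrite root5_phi; ring [(phi_sq s)].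
Qed.

Lemma cong_root5_phi_pow_m1 : cong_root5 (fun s => phi_pow s (-1)) 2.
Proof.
  apply cong_root5_ext with (fun s => phi_pow s 1 + IZR (-1)).
  - intros s; rewrite phi_pow_m1, phi_pow_1; ring.
  - apply (cong_root5_add _ _ 3 (-1)); [apply cong_root5_phi_pow_1|apply cong_root5_IZR].
Qed.

Lemma cong_root5_phi_pow_2 : cong_root5 (fun s => phi_pow s 2) (-1).
Proof. apply (cong_root5_phi_pow_add 1 1 3 3); [now exists 2%Z|apply cong_root5_phi_pow_1..]. Qed.

Lemma cong_root5_phi_pow_4 (i : Z) : cong_root5 (fun s => phi_pow s (4 * i)) 1.
Proof.
  induction i as [|i IH|i IH] using Z.peano_ind.
  - exact (cong_root5_IZR 1).
  - replace (4 * Z.succ i)%Z with (4 * i + (2 + 2))%Z by lia.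
    apply (cong_root5_phi_pow_add _ _ 1 1); [now exists 0%Z|assumption|].
    apply (cong_root5_phi_pow_add _ _ (-1) (-1)); [now exists 0%Z|apply cong_root5_phi_pow_2..].
  - replace (4 * Z.pred i)%Z with (4 * i + ((-1 + -1) + (-1 + -1)))%Z by lia.
    assert (Hm2 : cong_root5 (fun s => phi_pow s (-1 + -1)) (-1))
      by (apply (cong_root5_phi_pow_add _ _ 2 2); [now exists 1%Z|apply cong_root5_phi_pow_m1..]).
    apply (cong_root5_phi_pow_add _ _ 1 1); [now exists 0%Z|assumption|].
    now apply (cong_root5_phi_pow_add _ _ (-1) (-1)); [exists 0%Z| |].
Qed.

Lemma cong_root5_phi_pow_shift (i j c : Z) :
  cong_root5 (fun s => phi_pow s j) c -> cong_root5 (fun s => phi_pow s (4 * i + j)) c.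
Proof.
  intros Hj; apply (cong_root5_phi_pow_add _ _ 1 c);
    [exists 0%Z; lia|apply cong_root5_phi_pow_4|assumption].
Qed.

Lemma cong_root5_scaled_phi_pow (z : bool -> R) (a k c : Z) :
  (forall s, z s = IZR a * phi_pow s k) -> cong_root5 (fun s => phi_pow s k) c ->
  cong_root5 z (a * c).
Proof.
  intros E Hk; apply cong_root5_ext with (1 := E), cong_root5_mul;
    [apply cong_root5_IZR|assumption].
Qed.

Lemma phi_pow_4k_below_or_cong (z : bool -> R) : in_Zphi z -> (forall s, 0 < z s) ->
  (exists i, forall s, phi_pow s (4 * i) <= z s) \/
  (exists c, (1 <= c <= 2)%Z /\ cong_root5 z (- c)).
Proof.
  intros Hz Hpos; destruct (in_Zphi_two_units_below z Hz Hpos) as (k&Hk&Hk').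
  destruct (Z.Even_or_Odd k) as [[i ->]|[i ->]].
  - left; exists i; now replace (4 * i)%Z with (2 * (2 * i))%Z by lia.
  - destruct Hk' as [Hk'|(c&Hc&E)].
    + left; exists (i + 1)%Z; now replace (4 * (i + 1))%Z with (2 * (2 * i + 1 + 1))%Z by lia.
    + right; exists c; split; [assumption|]; replace (- c)%Z with (c * -1)%Z by lia.
      apply cong_root5_scaled_phi_pow with (1 := E).
      replace (2 * (2 * i + 1))%Z with (4 * i + 2)%Z by lia.
      apply cong_root5_phi_pow_shift, cong_root5_phi_pow_2.
Qed.

Lemma phi_pow_4k_plus_2_below_or_cong (z : bool -> R) : in_Zphi z -> (forall s, 0 < z s) ->
  (exists i, forall s, phi_pow s (4 * i + 2) <= z s) \/
  (exists c, (1 <= c <= 2)%Z /\ cong_root5 z c).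
Proof.
  intros Hz Hpos; destruct (in_Zphi_two_units_below z Hz Hpos) as (k&Hk&Hk').
  destruct (Z.Even_or_Odd k) as [[i ->]|[i ->]].
  - destruct Hk' as [Hk'|(c&Hc&E)].
    + left; exists i; now replace (4 * i + 2)%Z with (2 * (2 * i + 1))%Z by lia.
    + right; exists c; split; [assumption|]; replace c with (c * 1)%Z by lia.
      apply cong_root5_scaled_phi_pow with (1 := E).
      replace (2 * (2 * i))%Z with (4 * i)%Z by lia; apply cong_root5_phi_pow_4.
  - left; exists i; now replace (4 * i + 2)%Z with (2 * (2 * i + 1))%Z by lia.
Qed.

(* The units [phi^(4i)] and [phi^(4i+2)] are [1] and [-1] modulo [sqrt 5], so the residues of
   elements with only one kind of unit below them tell the two kinds apart. *)
Lemma congruent_units_below (z w : bool -> R) :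
  in_Zphi z -> (forall s, 0 < z s) -> in_Zphi w -> (forall s, 0 < w s) ->
  in_Zphi (fun s => (z s - w s) / root5 s) ->
  exists k i, (forall s, phi_pow s (2 * k) <= z s) /\
    (forall s, phi_pow s (2 * k + 4 * i) <= w s).
Proof.
  intros Hz Pz Hw Pw Hzw.
  assert (Hwz : in_Zphi (fun s => (w s - z s) / root5 s)).
  { apply in_Zphi_ext with (fun s => - ((z s - w s) / root5 s)); [|now apply in_Zphi_opp].
    intros s; field; apply root5_neq_0. }
  assert (Hodd : forall c, (1 <= c <= 2)%Z -> cong_root5 z (- c) ->
    exists k i, (forall s, phi_pow s (2 * k) <= z s) /\
      (forall s, phi_pow s (2 * k + 4 * i) <= w s)).
  { intros c Hc Hzc; assert (Hwc := cong_root5_trans w z _ Hwz Hzc).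
    destruct (phi_pow_4k_plus_2_below_or_cong z Hz Pz) as [(i&Hi)|(c'&Hc'&Hzc')].
    2:{ destruct (cong_root5_unique z _ _ Hzc Hzc'); lia. }
    destruct (phi_pow_4k_plus_2_below_or_cong w Hw Pw) as [(j&Hj)|(c'&Hc'&Hwc')].
    2:{ destruct (cong_root5_unique w _ _ Hwc Hwc'); lia. }
    exists (2 * i + 1)%Z, (j - i)%Z; split.
    - now replace (2 * (2 * i + 1))%Z with (4 * i + 2)%Z by lia.
    - now replace (2 * (2 * i + 1) + 4 * (j - i))%Z with (4 * j + 2)%Z by lia. }
  destruct (phi_pow_4k_below_or_cong z Hz Pz) as [(i&Hi)|(c&Hc&Hzc)]; [|now apply (Hodd c)].
  destruct (phi_pow_4k_below_or_cong w Hw Pw) as [(j&Hj)|(c&Hc&Hwc)].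
  - exists (2 * i)%Z, (j - i)%Z; split.
    + now replace (2 * (2 * i))%Z with (4 * i)%Z by lia.
    + now replace (2 * (2 * i) + 4 * (j - i))%Z with (4 * j)%Z by lia.
  - apply (Hodd c Hc); now apply cong_root5_trans with w.
Qed.

(** * The four embeddings of [K] *)

(* [a = u + v sqrt p] with [u = base_part a] and [v = root_part a] in [Q(sqrt 5)]. *)
Definition base_part (a : el) (s : bool) : R := e0 a + e1 a * root5 s.
Definition root_part (a : el) (s : bool) : R := e2 a + e3 a * root5 s.

Definition of_parts (u v : bool -> R) : el :=
  El ((u true + u false) / 2) ((u true - u false) / (2 * sqrt 5))
     ((v true + v false) / 2) ((v true - v false) / (2 * sqrt 5)).

Lemma parts_ext (a b : el) :
  (forall s, base_part a s = base_part b s) -> (forall s, root_part a s = root_part b s) -> a = b.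
Proof.
  unfold base_part, root_part; intros Hb Hr.
  pose proof (root5_neq_0 true); assert (Hconj5 := root5_negb true).
  pose proof (Hb true); assert (Hb2 := Hb false); pose proof (Hr true); assert (Hr2 := Hr false).
  simpl in Hconj5; rewrite Hconj5 in Hb2, Hr2.
  apply el_ext; [lra|apply Rmult_eq_reg_r with (root5 true); lra
                |lra|apply Rmult_eq_reg_r with (root5 true); lra].
Qed.

Lemma base_part_of_parts (u v : bool -> R) (s : bool) : base_part (of_parts u v) s = u s.
Proof.
  pose proof sqrt5_bounds; unfold base_part, of_parts, root5; destruct s; simpl; field; lra.
Qed.

Lemma root_part_of_parts (u v : bool -> R) (s : bool) : root_part (of_parts u v) s = v s.
Proof.
  pose proof sqrt5_bounds; unfold root_part, of_parts, root5; destruct s; simpl; field; lra.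
Qed.

Lemma base_part_mul (p : Z) (a b : el) (s : bool) : base_part (elmul p a b) s =
  base_part a s * base_part b s + IZR p * (root_part a s * root_part b s).
Proof. unfold base_part, root_part; simpl; ring [(root5_sq s)]. Qed.

Lemma root_part_mul (p : Z) (a b : el) (s : bool) : root_part (elmul p a b) s =
  base_part a s * root_part b s + root_part a s * base_part b s.
Proof. unfold base_part, root_part; simpl; ring [(root5_sq s)]. Qed.

Lemma base_part_sub (a b : el) (s : bool) :
  base_part (elsub a b) s = base_part a s - base_part b s.
Proof. unfold base_part; simpl; ring. Qed.

Lemma root_part_sub (a b : el) (s : bool) :
  root_part (elsub a b) s = root_part a s - root_part b s.
Proof. unfold root_part; simpl; ring. Qed.

Lemma base_part_conj (a : el) (s : bool) : base_part (elconj true false a) s = base_part a s.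
Proof. unfold base_part; simpl; ring. Qed.

Lemma root_part_conj (a : el) (s : bool) : root_part (elconj true false a) s = - root_part a s.
Proof. unfold root_part; simpl; ring. Qed.

Section Embeddings.
Variable p : Z.
Hypothesis p_pos : (0 < p)%Z.

Lemma sqrt_p_pos : 0 < sqrt (IZR p).
Proof. apply sqrt_lt_R0; now apply IZR_lt. Qed.

Lemma sqrt_p_sq : sqrt (IZR p) * sqrt (IZR p) = IZR p.
Proof. apply sqrt_sqrt, IZR_le; lia. Qed.

Lemma sigma_parts (s t : bool) (a : el) :
  sigma p s t a = base_part a s + sg t * root_part a s * sqrt (IZR p).
Proof.
  unfold sigma, base_part, root_part, root5.
  rewrite sqrt_mult by (try apply IZR_le; lia || lra); ring.
Qed.

Lemma sigma_ext (a b : el) : (forall s t, sigma p s t a = sigma p s t b) -> a = b.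
Proof.
  intros H; pose proof sqrt_p_pos.
  assert (Hparts : forall s, base_part a s = base_part b s /\ root_part a s = root_part b s).
  { intros s; assert (Htrue := H s true); assert (Hparts := H s false).
    rewrite !sigma_parts in Htrue, Hparts; simpl in Htrue, Hparts.
    split; [lra|apply Rmult_eq_reg_r with (sqrt (IZR p)); lra]. }
  apply parts_ext; intros s; apply Hparts.
Qed.

Lemma sigma_mul (s t : bool) (a b : el) :
  sigma p s t (elmul p a b) = sigma p s t a * sigma p s t b.
Proof.
  rewrite !sigma_parts, base_part_mul, root_part_mul.
  assert (Hsp := sqrt_p_sq); destruct t; simpl; ring [Hsp].
Qed.

Lemma sigma_add (s t : bool) (a b : el) :
  sigma p s t (eladd a b) = sigma p s t a + sigma p s t b.
Proof. unfold sigma; simpl; ring. Qed.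

Lemma sigma_sub (s t : bool) (a b : el) :
  sigma p s t (elsub a b) = sigma p s t a - sigma p s t b.
Proof. unfold sigma; simpl; ring. Qed.

Lemma sigma_zero (s t : bool) : sigma p s t el0 = 0.
Proof. unfold sigma; simpl; ring. Qed.

Lemma sigma_one (s t : bool) : sigma p s t el1 = 1.
Proof. unfold sigma; simpl; ring. Qed.

Lemma sigma_conj (s t : bool) (a : el) :
  sigma p s t (elconj true false a) = sigma p s (negb t) a.
Proof. unfold sigma; destruct s, t; simpl; ring. Qed.

Lemma sigma_of_parts (s t : bool) (u v : bool -> R) :
  sigma p s t (of_parts u v) = u s + sg t * v s * sqrt (IZR p).
Proof. now rewrite sigma_parts, base_part_of_parts, root_part_of_parts. Qed.

Definition elnorm (a : el) : R :=
  (sigma p true true a * sigma p true false a) * (sigma p false true a * sigma p false false a).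

Lemma elnorm_mul (a b : el) : elnorm (elmul p a b) = elnorm a * elnorm b.
Proof. unfold elnorm; rewrite !sigma_mul; ring. Qed.

Lemma elnorm_one : elnorm el1 = 1.
Proof. unfold elnorm; rewrite !sigma_one; ring. Qed.

Lemma sigma_relative_norm (s : bool) (a : el) :
  sigma p s true a * sigma p s false a =
  base_part a s * base_part a s - IZR p * (root_part a s * root_part a s).
Proof. rewrite !sigma_parts; simpl; ring [sqrt_p_sq]. Qed.

End Embeddings.

(** * Totally positive integers and units *)

Record radicand (p : Z) : Prop := {
  radicand_pos : (0 < p)%Z;
  radicand_sqfree : Zsqfree p;
  radicand_mul5_sqfree : Zsqfree (5 * p);
  radicand_mod4 : (exists k, p = 4 * k + 3)%Z
}.

Section BiquadraticField.
Variable p : Z.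
Hypothesis p_radicand : radicand p.
Let p_pos : (0 < p)%Z := radicand_pos p p_radicand.
Add Ring el_ring_totpos : (el_ring_theory p).

Lemma in_OK_iff_parts (a : el) :
  in_OK p a <-> in_Zphi (base_part a) /\ in_Zphi (root_part a).
Proof.
  assert (Hgolden : forall x y z t s, base_part (golden_el x y z t) s = IZR x + IZR y * phi s /\
    root_part (golden_el x y z t) s = IZR z + IZR t * phi s).
  { intros; unfold base_part, root_part, phi; simpl; split; field. }
  split.
  - intros Ha; destruct (in_OK_is_golden_el p) with (a := a) as (x&y&z&t&->); try apply p_radicand;
      [assumption|].
    split; [exists x, y|exists z, t]; intros s; apply Hgolden.
  - intros ((x&y&Eb)&(z&t&Er)).
    replace a with (golden_el x y z t); [apply in_OK_golden_el|].
    apply parts_ext; intros s; rewrite ?Eb, ?Er; apply Hgolden.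
Qed.

Lemma in_OK_of_parts (u v : bool -> R) : in_Zphi u -> in_Zphi v -> in_OK p (of_parts u v).
Proof.
  intros Hu Hv; apply in_OK_iff_parts; split.
  - apply in_Zphi_ext with (2 := Hu), base_part_of_parts.
  - apply in_Zphi_ext with (2 := Hv), root_part_of_parts.
Qed.

Lemma in_OK_one : in_OK p el1.
Proof.
  apply in_OK_iff_parts; split; [exists 1%Z, 0%Z|exists 0%Z, 0%Z]; intros s;
    unfold base_part, root_part; simpl; ring.
Qed.

Lemma in_OK_mul (a b : el) : in_OK p a -> in_OK p b -> in_OK p (elmul p a b).
Proof.
  intros [Ba Ra]%in_OK_iff_parts [Bb Rb]%in_OK_iff_parts; apply in_OK_iff_parts; split.
  - apply in_Zphi_ext with (1 := base_part_mul p a b); auto with zphi.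
  - apply in_Zphi_ext with (1 := root_part_mul p a b); auto with zphi.
Qed.

Lemma in_OK_sub (a b : el) : in_OK p a -> in_OK p b -> in_OK p (elsub a b).
Proof.
  intros [Ba Ra]%in_OK_iff_parts [Bb Rb]%in_OK_iff_parts; apply in_OK_iff_parts; split.
  - apply in_Zphi_ext with (1 := base_part_sub a b); auto with zphi.
  - apply in_Zphi_ext with (1 := root_part_sub a b); auto with zphi.
Qed.

Lemma in_OK_conj (a : el) : in_OK p a -> in_OK p (elconj true false a).
Proof.
  intros [Ba Ra]%in_OK_iff_parts; apply in_OK_iff_parts; split.
  - apply in_Zphi_ext with (1 := base_part_conj a); assumption.
  - apply in_Zphi_ext with (1 := root_part_conj a); auto with zphi.
Qed.

Lemma totpos_mul (a b : el) : totpos p a -> totpos p b -> totpos p (elmul p a b).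
Proof.
  intros [Ha Pa] [Hb Pb]; split; [now apply in_OK_mul|].
  intros; rewrite sigma_mul by exact p_pos; now apply Rmult_lt_0_compat.
Qed.

Lemma totpos_one : totpos p el1.
Proof. split; [apply in_OK_one|]; intros; rewrite sigma_one; lra. Qed.

Lemma totpos_conj (a : el) : totpos p a -> totpos p (elconj true false a).
Proof.
  intros [Ha Pa]; split; [now apply in_OK_conj|].
  intros; rewrite sigma_conj; apply Pa.
Qed.

Lemma tp_unit_intro (e f : el) :
  totpos p e -> in_OK p f -> elmul p e f = el1 -> tp_unit p e.
Proof. intros He Hf Hef; split; [|assumption]; split; [apply He|now exists f]. Qed.

Lemma tp_unit_relative_norm_one (e : el) : in_OK p e -> (forall s, 0 < base_part e s) ->
  elmul p e (elconj true false e) = el1 -> tp_unit p e.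
Proof.
  intros He Hpos Hnorm; apply tp_unit_intro with (elconj true false e);
    [|now apply in_OK_conj|assumption].
  split; [assumption|]; intros s t.
  assert (Hinv : sigma p s t e * sigma p s (negb t) e = 1)
    by (rewrite <- sigma_conj, <- sigma_mul, Hnorm by exact p_pos; apply sigma_one).
  assert (Htrace : sigma p s t e + sigma p s (negb t) e = 2 * base_part e s)
    by (rewrite !sigma_parts by exact p_pos; destruct t; simpl; ring).
  specialize (Hpos s); nra.
Qed.

Lemma tp_unit_inv (e : el) :
  tp_unit p e -> exists f, tp_unit p f /\ elmul p e f = el1.
Proof.
  intros ((He&f&Hf&Hef)&Pe); exists f; split; [|assumption].
  apply tp_unit_intro with e; [|assumption|rewrite <- Hef; ring].
  split; [assumption|]; intros s t.
  assert (Hinv : sigma p s t e * sigma p s t f = 1)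
    by (rewrite <- sigma_mul, Hef by exact p_pos; apply sigma_one).
  pose proof (proj2 Pe s t); nra.
Qed.

Lemma tp_unit_mul (e f : el) : tp_unit p e -> tp_unit p f -> tp_unit p (elmul p e f).
Proof.
  intros He Hf.
  destruct (tp_unit_inv e He) as (e'&He'&Ee), (tp_unit_inv f Hf) as (f'&Hf'&Ef).
  apply tp_unit_intro with (elmul p e' f').
  - apply totpos_mul; [apply He|apply Hf].
  - apply in_OK_mul; [apply He'|apply Hf'].
  - transitivity (elmul p (elmul p e e') (elmul p f f')); [ring|rewrite Ee, Ef; ring].
Qed.

Lemma tp_unit_one : tp_unit p el1.
Proof. apply tp_unit_intro with el1; [apply totpos_one|apply in_OK_one|ring]. Qed.

Lemma tp_unit_power (e : el) (k : Z) : tp_unit p e ->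
  exists f, tp_unit p f /\ forall s t, sigma p s t f = powerRZ (sigma p s t e) k.
Proof.
  intros He; destruct (tp_unit_inv e He) as (e'&He'&Ee).
  assert (Ne : forall s t, sigma p s t e <> 0)
    by (intros s t; pose proof (proj2 (proj2 He) s t); lra).
  assert (Ie : forall s t, sigma p s t e' = powerRZ (sigma p s t e) (-1)).
  { intros s t; apply Rmult_eq_reg_l with (sigma p s t e); [|apply Ne].
    rewrite <- sigma_mul, Ee, sigma_one by exact p_pos; simpl; field; apply Ne. }
  induction k as [|k (f&Hf&IH)|k (f&Hf&IH)] using Z.peano_ind.
  - exists el1; split; [apply tp_unit_one|]; intros; apply sigma_one.
  - exists (elmul p f e); split; [now apply tp_unit_mul|]; intros s t.
    rewrite sigma_mul, IH, <- Z.add_1_r, powerRZ_add, powerRZ_1; auto.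
  - exists (elmul p f e'); split; [now apply tp_unit_mul|]; intros s t.
    rewrite sigma_mul, IH, <- Z.sub_1_r, Ie, <- powerRZ_add; auto.
Qed.

Lemma assoc_refl (a : el) : assoc p a a.
Proof. exists el1; split; [apply tp_unit_one|ring]. Qed.

Lemma assoc_sym (a b : el) : assoc p a b -> assoc p b a.
Proof.
  intros (e&He&->); destruct (tp_unit_inv e He) as (f&Hf&Ef).
  exists f; split; [assumption|].
  transitivity (elmul p (elmul p e f) b); [rewrite Ef; ring|ring].
Qed.

Lemma assoc_trans (a b c : el) : assoc p a b -> assoc p b c -> assoc p a c.
Proof.
  intros (e&He&->) (f&Hf&->); exists (elmul p e f); split; [now apply tp_unit_mul|ring].
Qed.

Lemma assoc_one_tp_unit (e : el) : tp_unit p e -> assoc p e el1.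
Proof. intros He; exists e; split; [assumption|ring]. Qed.

Lemma indec_assoc (a b : el) : assoc p a b -> indec p b -> indec p a.
Proof.
  intros (e&He&->) [Pb Hb]; destruct (tp_unit_inv e He) as (f&Hf&Ef).
  split; [apply totpos_mul; [apply He|assumption]|].
  intros (c&d&Hc&Hd&E); apply Hb; exists (elmul p f c), (elmul p f d).
  split; [|split]; try (apply totpos_mul; [apply Hf|assumption]).
  transitivity (elmul p f (elmul p e b)); [|rewrite E; ring].
  transitivity (elmul p (elmul p e f) b); [rewrite Ef; ring|ring].
Qed.

Lemma indec_conj (a : el) : indec p a -> indec p (elconj true false a).
Proof.
  intros [Pa Ha]; split; [now apply totpos_conj|].
  intros (b&c&Hb&Hc&E); apply Ha; exists (elconj true false b), (elconj true false c).
  split; [|split]; try now apply totpos_conj.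
  rewrite <- (elconj_involutive true false a), E; apply elconj_add.
Qed.

Lemma indec_eq_of_sub (a b : el) :
  indec p a -> totpos p b -> (elsub a b = el0 \/ totpos p (elsub a b)) -> a = b.
Proof.
  intros [Pa Ha] Hb [H|H].
  - transitivity (eladd (elsub a b) b); [ring|rewrite H; ring].
  - exfalso; apply Ha; exists b, (elsub a b); split; [|split]; try assumption; ring.
Qed.

Lemma elnorm_isZ (a : el) : in_OK p a -> isZ (elnorm p a).
Proof.
  intros [Ha Ha']%in_OK_iff_parts; unfold elnorm; rewrite !sigma_relative_norm by exact p_pos.
  apply (in_Zphi_norm_isZ (fun s => base_part a s * base_part a s
    - IZR p * (root_part a s * root_part a s))); auto with zphi.
Qed.

Lemma elnorm_totpos (a : el) : totpos p a -> 1 <= elnorm p a.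
Proof.
  intros [Ha Pa]; apply isZ_pos_ge_1; [now apply elnorm_isZ|].
  unfold elnorm; repeat apply Rmult_lt_0_compat; apply Pa.
Qed.

Lemma elnorm_tp_unit (e : el) : tp_unit p e -> elnorm p e = 1.
Proof.
  intros He; destruct (tp_unit_inv e He) as (f&Hf&Ef).
  pose proof (elnorm_totpos e (proj2 He)); pose proof (elnorm_totpos f (proj2 Hf)).
  assert (Hmul : elnorm p e * elnorm p f = 1)
    by (rewrite <- elnorm_mul, Ef by exact p_pos; apply elnorm_one).
  nra.
Qed.

Lemma elnorm_assoc (a b : el) : assoc p a b -> elnorm p a = elnorm p b.
Proof. intros (e&He&->); rewrite elnorm_mul, (elnorm_tp_unit e He) by exact p_pos; ring. Qed.

Lemma indec_one : indec p el1.
Proof.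
  split; [apply totpos_one|]; intros (b&c&Hb&Hc&E).
  assert (Hsmall : forall s t, 0 < sigma p s t b < 1).
  { intros s t; pose proof (proj2 Hb s t); pose proof (proj2 Hc s t).
    assert (Hsum := sigma_add p s t b c); rewrite <- E, sigma_one in Hsum; lra. }
  assert (Hinterval : forall x y, 0 < x < 1 -> 0 < y < 1 -> 0 < x * y < 1) by (intros; nra).
  assert (Hnorm := elnorm_totpos b Hb); unfold elnorm in Hnorm.
  pose proof (Hinterval _ _ (Hinterval _ _ (Hsmall true true) (Hsmall true false))
    (Hinterval _ _ (Hsmall false true) (Hsmall false false))); lra.
Qed.

Definition phi_unit (k : Z) : el := of_parts (fun s => phi_pow s (2 * k)) (fun _ => 0).

Lemma sigma_phi_unit (s t : bool) (k : Z) : sigma p s t (phi_unit k) = phi_pow s (2 * k).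
Proof. unfold phi_unit; rewrite sigma_of_parts by exact p_pos; ring. Qed.

Lemma base_part_phi_unit_mul (k : Z) (a : el) (s : bool) :
  base_part (elmul p (phi_unit k) a) s = phi_pow s (2 * k) * base_part a s.
Proof. unfold phi_unit; rewrite base_part_mul, base_part_of_parts, root_part_of_parts; ring. Qed.

Lemma root_part_phi_unit_mul (k : Z) (a : el) (s : bool) :
  root_part (elmul p (phi_unit k) a) s = phi_pow s (2 * k) * root_part a s.
Proof. unfold phi_unit; rewrite root_part_mul, base_part_of_parts, root_part_of_parts; ring. Qed.

Lemma tp_unit_phi_unit (k : Z) : tp_unit p (phi_unit k).
Proof.
  assert (HO : forall j, in_OK p (phi_unit j))
    by (intros j; apply in_OK_of_parts; [apply in_Zphi_phi_pow|apply (in_Zphi_IZR 0)]).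
  apply tp_unit_intro with (phi_unit (- k)); [split|..]; [apply HO| |apply HO|].
  - intros s t; rewrite sigma_phi_unit; apply phi_pow_even_pos.
  - apply (sigma_ext p p_pos); intros s t.
    rewrite sigma_mul, !sigma_phi_unit, sigma_one, <- phi_pow_add by exact p_pos.
    replace (2 * k + 2 * - k)%Z with 0%Z by lia; apply phi_pow_0.
Qed.

Lemma assoc_phi_unit_mul (k : Z) (a : el) : assoc p (elmul p (phi_unit k) a) a.
Proof. exists (phi_unit k); split; [apply tp_unit_phi_unit|reflexivity]. Qed.

Definition cone_coords (w a : el) (l m : bool -> R) : Prop :=
  in_Zphi (fun s => root5 s * l s) /\ in_Zphi (fun s => root5 s * m s) /\
  forall s t, sigma p s t a = l s + m s * sigma p s t w.

Lemma cone_zero_or_totpos (w a : el) (l m : bool -> R) :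
  totpos p w -> in_OK p a -> cone_coords w a l m ->
  (forall s, 0 <= l s) -> (forall s, 0 <= m s) -> a = el0 \/ totpos p a.
Proof.
  intros [_ Hw] Ha (Hl&Hm&E) Pl Pm.
  assert (Hmw : forall s t, 0 <= m s * sigma p s t w)
    by (intros; apply Rmult_le_pos; [apply Pm|left; apply Hw]).
  destruct (root5_multiple_sign l Hl Pl) as [Zl|Ql].
  - destruct (root5_multiple_sign m Hm Pm) as [Zm|Qm].
    + left; apply (sigma_ext p p_pos); intros s t; rewrite E, Zl, Zm, sigma_zero; ring.
    + right; split; [assumption|]; intros s t; rewrite E.
      pose proof (Rmult_lt_0_compat _ _ (Qm s) (Hw s t)); specialize (Pl s); lra.
  - right; split; [assumption|]; intros s t; rewrite E.
    specialize (Ql s); specialize (Hmw s t); lra.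
Qed.

Lemma indec_cone_eq (w a b : el) (l m l' m' : bool -> R) :
  totpos p w -> indec p a -> totpos p b -> cone_coords w a l m -> cone_coords w b l' m' ->
  (forall s, l' s <= l s) -> (forall s, m' s <= m s) -> a = b.
Proof.
  intros Hw Ha Hb (Al&Am&Ea) (Bl&Bm&Eb) Hl Hm.
  apply indec_eq_of_sub; [assumption..|].
  apply cone_zero_or_totpos with w (fun s => l s - l' s) (fun s => m s - m' s).
  - assumption.
  - apply in_OK_sub; [apply Ha|apply Hb].
  - split; [|split].
    + apply in_Zphi_ext with (fun s => root5 s * l s - root5 s * l' s); [intros; ring|].
      now apply in_Zphi_sub.
    + apply in_Zphi_ext with (fun s => root5 s * m s - root5 s * m' s); [intros; ring|].
      now apply in_Zphi_sub.
    + intros s t; rewrite sigma_sub, Ea, Eb; ring.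
  - intros s; specialize (Hl s); lra.
  - intros s; specialize (Hm s); lra.
Qed.

Lemma indec_cone_integral_l_assoc_one (w a : el) (l m : bool -> R) :
  totpos p w -> indec p a -> cone_coords w a l m -> in_Zphi l ->
  (forall s, 0 < l s) -> (forall s, 0 <= m s) -> assoc p a el1.
Proof.
  intros Hw Ha Hc Hl Pl Pm; destruct (in_Zphi_unit_below l Hl Pl) as (k&Hk).
  replace a with (phi_unit k); [apply assoc_one_tp_unit, tp_unit_phi_unit|symmetry].
  apply (indec_cone_eq w a _ l m (fun s => phi_pow s (2 * k)) (fun _ => 0));
    try assumption; [apply tp_unit_phi_unit|].
  split; [auto with zphi|split; [auto with zphi|]].
  intros s t; rewrite sigma_phi_unit; ring.
Qed.

Lemma indec_cone_integral_m_assoc_one (w a : el) (l m : bool -> R) :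
  tp_unit p w -> indec p a -> cone_coords w a l m -> in_Zphi m ->
  (forall s, 0 <= l s) -> (forall s, 0 < m s) -> assoc p a el1.
Proof.
  intros Hw Ha Hc Hm Pl Pm; destruct (in_Zphi_unit_below m Hm Pm) as (k&Hk).
  assert (Hu : tp_unit p (elmul p (phi_unit k) w))
    by (apply tp_unit_mul; [apply tp_unit_phi_unit|assumption]).
  replace a with (elmul p (phi_unit k) w); [now apply assoc_one_tp_unit|symmetry].
  apply (indec_cone_eq w a _ l m (fun _ => 0) (fun s => phi_pow s (2 * k)));
    try assumption; [apply Hw|apply Hu|].
  split; [auto with zphi|split; [auto with zphi|]].
  intros s t; rewrite sigma_mul, sigma_phi_unit by exact p_pos; ring.
Qed.

Definition in_cone (w a : el) : Prop := exists l m : bool -> R,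
  (forall s, 0 <= l s) /\ (forall s, 0 <= m s) /\
  forall s t, sigma p s t a = l s + m s * sigma p s t w.

Lemma in_cone_placewise (w a : el) :
  (forall s, exists l m, 0 <= l /\ 0 <= m /\ forall t, sigma p s t a = l + m * sigma p s t w) ->
  in_cone w a.
Proof.
  intros H; destruct (H true) as (l1&m1&Hl1&Hm1&E1), (H false) as (l2&m2&Hl2&Hm2&E2).
  exists (fun s : bool => if s then l1 else l2), (fun s : bool => if s then m1 else m2).
  split; [intros []; assumption|split; [intros []; assumption|intros []; assumption]].
Qed.

Lemma parts_of_combination (w a : el) (l m : bool -> R) :
  (forall s t, sigma p s t a = l s + m s * sigma p s t w) ->
  forall s, base_part a s = l s + m s * base_part w s /\ root_part a s = m s * root_part w s.
Proof.
  intros Ha s; assert (Hplus := Ha s true); assert (Hminus := Ha s false).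
  pose proof (sqrt_p_pos p p_pos).
  rewrite !sigma_parts in Hplus, Hminus by exact p_pos; simpl in Hplus, Hminus.
  split; [lra|apply Rmult_eq_reg_r with (sqrt (IZR p)); lra].
Qed.

Lemma in_cone_of_logs (w a : el) (G : bool -> R) :
  totpos p w -> totpos p a -> (forall s t, ln (sigma p s t w) = sg t * G s) ->
  (forall s, let d := ln (sigma p s true a) - ln (sigma p s false a) in
     (0 < G s /\ 0 <= d <= 2 * G s) \/ (G s < 0 /\ 2 * G s <= d <= 0)) -> in_cone w a.
Proof.
  intros [_ Pw] [_ Pa] HG HD; apply in_cone_placewise; intros s.
  assert (Gplus := HG s true); assert (Gminus := HG s false); simpl in Gplus, Gminus.
  destruct (HD s) as [[HG0 Hd]|[HG0 Hd]].
  - destruct (plane_cone_of_log_strip (sigma p s true w) (sigma p s false w)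
      (sigma p s true a) (sigma p s false a)) as (l&m&Hl&Hm&E1&E2); auto; try lra.
    exists l, m; split; [assumption|split; [assumption|intros []; assumption]].
  - destruct (plane_cone_of_log_strip (sigma p s false w) (sigma p s true w)
      (sigma p s false a) (sigma p s true a)) as (l&m&Hl&Hm&E1&E2); auto; try lra.
    exists l, m; split; [assumption|split; [assumption|intros []; assumption]].
Qed.

Lemma unit_reduction (eps eta a : el) (E G : R) :
  tp_unit p eps -> tp_unit p eta -> 0 < E -> E <= G ->
  (forall s t, ln (sigma p s t eps) = sg t * E) ->
  (forall s t, ln (sigma p s t eta) = sg t * (sg s * G)) ->
  totpos p a -> exists b, assoc p a b /\ (in_cone eps b \/ in_cone eta b).
Proof.
  intros Heps Heta HE HEG Leps Leta Ha.
  destruct (lattice_cover (2 * E) (2 * G)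
    (ln (sigma p true true a) - ln (sigma p true false a))
    (ln (sigma p false true a) - ln (sigma p false false a))) as (k&l&Hkl); [lra|lra|].
  destruct (tp_unit_power eps k Heps) as (e&He&Ee), (tp_unit_power eta l Heta) as (f&Hf&Ef).
  assert (Hef := tp_unit_mul e f He Hf).
  exists (elmul p (elmul p e f) a); split; [apply assoc_sym; now exists (elmul p e f)|].
  assert (Hlog : forall s t, ln (sigma p s t (elmul p (elmul p e f) a)) =
    sg t * (IZR k * E + sg s * (IZR l * G)) + ln (sigma p s t a)).
  { intros s t; rewrite !sigma_mul, Ee, Ef by exact p_pos.
    assert (Peps := proj2 (proj2 Heps) s t); assert (Peta := proj2 (proj2 Heta) s t).
    pose proof (proj2 Ha s t); pose proof (powerRZ_lt _ k Peps); pose proof (powerRZ_lt _ l Peta).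
    rewrite !ln_mult, !ln_powerRZ, Leps, Leta
      by (try assumption; now apply Rmult_lt_0_compat); ring. }
  assert (Hb : totpos p (elmul p (elmul p e f) a)) by (apply totpos_mul; [apply Hef|assumption]).
  simpl in Hkl; destruct Hkl as [Hkl|Hkl]; [left|right].
  - apply in_cone_of_logs with (fun _ => E); [apply Heps|assumption|assumption|].
    intros s; rewrite !Hlog; destruct s; simpl; left; lra.
  - apply in_cone_of_logs with (fun s => sg s * G); [apply Heta|assumption|assumption|].
    intros s; rewrite !Hlog; destruct s; simpl; [left|right]; lra.
Qed.

(** * Counting representatives *)

Lemma finite_choice (B : Type) (b0 : B) (Q : nat -> B -> Prop) (m : nat) :
  (forall i, (i < m)%nat -> exists b, Q i b) ->
  exists f, forall i, (i < m)%nat -> Q i (f i).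
Proof.
  induction m as [|m IH]; intros H.
  - exists (fun _ => b0); lia.
  - destruct IH as (f&Hf); [intros; apply H; lia|].
    destruct (H m) as (b&Hb); [lia|].
    exists (fun i => if Nat.eqb i m then b else f i); intros i Hi.
    destruct (Nat.eqb_spec i m) as [->|]; [assumption|apply Hf; lia].
Qed.

Lemma bounded_injection_le (a b : nat) (f : nat -> nat) :
  (forall i, (i < a)%nat -> (f i < b)%nat) ->
  (forall i j, (i < a)%nat -> (j < a)%nat -> f i = f j -> i = j) -> (a <= b)%nat.
Proof.
  intros Hlt Hinj.
  rewrite <- (List.length_seq a 0), <- (List.length_seq b 0), <- (List.length_map f (List.seq 0 a)).
  apply List.NoDup_incl_length.
  - apply List.NoDup_map_NoDup_ForallPairs; [|apply List.seq_NoDup].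
    intros i j Hi Hj; apply List.in_seq in Hi, Hj; apply Hinj; lia.
  - intros k Hk; apply List.in_map_iff in Hk; destruct Hk as (i&<-&Hi).
    apply List.in_seq in Hi; apply List.in_seq; specialize (Hlt i); lia.
Qed.

Lemma complete_reps_of_assoc (k : nat) (f g : nat -> el) :
  complete_reps p k f -> (forall i, (i < k)%nat -> assoc p (g i) (f i)) -> complete_reps p k g.
Proof.
  intros (Hindec&Hinj&Hsurj) Hgf; split; [|split].
  - intros i Hi; apply indec_assoc with (f i); auto.
  - intros i j Hi Hj Hij H; apply (Hinj i j Hi Hj Hij).
    apply assoc_trans with (g i); [apply assoc_sym; auto|].
    apply assoc_trans with (g j); auto.
  - intros a Ha; destruct (Hsurj a Ha) as (i&Hi&Hai); exists i; split; [assumption|].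
    apply assoc_trans with (f i); [assumption|apply assoc_sym; auto].
Qed.

Lemma complete_reps_le (k l : nat) (f g : nat -> el) :
  complete_reps p k f -> complete_reps p l g -> (k <= l)%nat.
Proof.
  intros (F1&F2&_) (_&_&G3).
  destruct (finite_choice _ 0%nat (fun i j => (j < l)%nat /\ assoc p (f i) (g j)) k) as (h&Hh).
  { intros i Hi; apply G3, F1, Hi. }
  apply bounded_injection_le with h; [intros; now apply Hh|].
  intros i j Hi Hj E; destruct (Nat.eq_dec i j) as [|Hne]; [assumption|exfalso].
  apply (F2 i j Hi Hj Hne).
  destruct (Hh i Hi) as [_ Ai], (Hh j Hj) as [_ Aj]; rewrite <- E in Aj.
  apply assoc_trans with (g (h i)); [assumption|now apply assoc_sym].
Qed.

Lemma iota_eq_unique (k : nat) (f : nat -> el) :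
  complete_reps p k f -> forall l, iota_eq p l <-> l = k.
Proof.
  intros Hf l; split.
  - intros (g&Hg); apply Nat.le_antisymm; [apply complete_reps_le with g f
      |apply complete_reps_le with f g]; assumption.
  - intros ->; now exists f.
Qed.

(** * The discriminant *)

Definition mat4_mul (M N : nat -> nat -> R) (k j : nat) : R :=
  M k 0%nat * N 0%nat j + M k 1%nat * N 1%nat j + M k 2%nat * N 2%nat j + M k 3%nat * N 3%nat j.

Lemma det4_mul (M N : nat -> nat -> R) : det4 (mat4_mul M N) = det4 M * det4 N.
Proof. unfold det4, det3, mat4_mul; ring. Qed.

Lemma det4_ext (M N : nat -> nat -> R) :
  (forall k j, (k < 4)%nat -> (j < 4)%nat -> M k j = N k j) -> det4 M = det4 N.
Proof. intros H; unfold det4, det3; rewrite !H by lia; reflexivity. Qed.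

Lemma det4_isZ (A : nat -> nat -> Z) : isZ (det4 (fun i j => IZR (A i j))).
Proof. unfold det4, det3; auto 20 with isz. Qed.

Definition golden_basis (i : nat) : el :=
  match i with
  | 0%nat => golden_el 1 0 0 0 | 1%nat => golden_el 0 1 0 0
  | 2%nat => golden_el 0 0 1 0 | _ => golden_el 0 0 0 1
  end.

Notation embedding_matrix w := (fun k j => sigma p (emb1 k) (emb2 k) (w j)).

Lemma in_OK_golden_basis (i : nat) : in_OK p (golden_basis i).
Proof. destruct i as [|[|[|i]]]; apply in_OK_golden_el. Qed.

Lemma golden_basis_span (a : el) : in_OK p a -> exists z, a = zcomb z golden_basis 4.
Proof.
  intros Ha; destruct (in_OK_is_golden_el p) with (a := a) as (x&y&u&t&->); try apply p_radicand;
    [assumption|].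
  exists (fun i => match i with 0%nat => x | 1%nat => y | 2%nat => u | _ => t end).
  apply el_ext; simpl; field.
Qed.

Lemma sigma_zcomb (z : nat -> Z) (w : nat -> el) (s t : bool) :
  sigma p s t (zcomb z w 4) =
  sigma p s t (w 0%nat) * IZR (z 0%nat) + sigma p s t (w 1%nat) * IZR (z 1%nat) +
  sigma p s t (w 2%nat) * IZR (z 2%nat) + sigma p s t (w 3%nat) * IZR (z 3%nat).
Proof. unfold sigma; simpl; ring. Qed.

Lemma det4_golden_basis : det4 (embedding_matrix golden_basis) ^ 2 = (20 * IZR p) ^ 2.
Proof.
  assert (Hsq5 : sqrt 5 * sqrt 5 = 5) by (apply sqrt_sqrt; lra).
  assert (Hsp := sqrt_p_sq p p_pos).
  assert (Hdet : det4 (embedding_matrix golden_basis) = - (20 * IZR p)).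
  { unfold det4, det3; rewrite !sigma_parts by exact p_pos.
    unfold base_part, root_part, root5; simpl; field_simplify_eq; ring [Hsq5 Hsp]. }
  rewrite Hdet; ring.
Qed.

Lemma det4_span (v w : nat -> el) :
  (forall i, (i < 4)%nat -> exists z, v i = zcomb z w 4) ->
  exists A : nat -> nat -> Z,
    det4 (embedding_matrix v) = det4 (embedding_matrix w) * det4 (fun i j => IZR (A i j)).
Proof.
  intros H; destruct (finite_choice _ (fun _ => 0%Z) _ 4 H) as (f&Hf).
  exists (fun i j => f j i); rewrite <- det4_mul; apply det4_ext.
  intros k j _ Hj; rewrite (Hf j Hj), sigma_zcomb; reflexivity.
Qed.

Lemma disc_eq_unique (D : R) : disc_eq p D -> D = (20 * IZR p) ^ 2.
Proof.
  intros (w&(Hw1&Hw2&_)&->); rewrite <- det4_golden_basis.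
  destruct (det4_span w golden_basis) as (A&HA); [intros; apply golden_basis_span; auto|].
  destruct (det4_span golden_basis w) as (B&HB); [intros; apply Hw2, in_OK_golden_basis|].
  destruct (det4_isZ A) as (a&Ha), (det4_isZ B) as (b&Hb).
  rewrite Ha in HA; rewrite Hb in HB.
  assert (Hneq0 : det4 (embedding_matrix golden_basis) <> 0).
  { intros Hzero; assert (Hdet := det4_golden_basis); rewrite Hzero in Hdet.
    assert (0 < IZR p) by (apply IZR_lt, p_pos); nra. }
  assert (Hab : (a * b = 1)%Z).
  { apply eq_IZR; rewrite mult_IZR.
    apply Rmult_eq_reg_l with (det4 (embedding_matrix golden_basis)); [|assumption].
    rewrite Rmult_1_r; rewrite HB at 2; rewrite HA; ring. }
  assert (a = 1 \/ a = -1)%Z as [-> | ->] by (apply Z.eq_mul_1 in Hab; lia);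
  rewrite HA; ring.
Qed.

(** * The fields with [p = Y^2 - 1] *)

Section Family.
Variables h X Y : Z.
Hypothesis h_pos : (1 <= h)%Z.
Hypothesis X_phi : forall s, IZR X = phi_pow s (4 * h - 1) - phi_pow s (- (4 * h - 1)).
Hypothesis Y_phi : forall s, root5 s * IZR Y = phi_pow s (4 * h - 1) + phi_pow s (- (4 * h - 1)).
Hypothesis p_Y : (p = Y * Y - 1)%Z.

Definition eps : el := of_parts (fun _ => IZR Y) (fun _ => 1).
Definition eta : el := of_parts (fun _ => IZR X) root5.

Lemma root5_Y (s : bool) : root5 s * IZR Y = IZR X + 2 * phi_pow s (- (4 * h - 1)).
Proof. rewrite (X_phi s), Y_phi; ring. Qed.

Lemma Y_sq : IZR Y * IZR Y = IZR p + 1.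
Proof. rewrite p_Y, minus_IZR, mult_IZR; ring. Qed.

Lemma X_sq : IZR X * IZR X = 5 * IZR p + 1.
Proof.
  assert (Hinv := phi_pow_opp_r true (4 * h - 1)).
  assert (HX := X_phi true); assert (HY := Y_phi true).
  assert (Hpell : 5 * (IZR Y * IZR Y) = IZR X * IZR X + 4).
  { transitivity ((root5 true * IZR Y) * (root5 true * IZR Y)); [ring [(root5_sq true)]|].
    rewrite HY, HX; ring [Hinv]. }
  rewrite Y_sq in Hpell; lra.
Qed.

Lemma phi_pow_lt_X (k : Z) : (k <= 4 * h - 2)%Z -> phi_pow true k < IZR X.
Proof.
  intros Hk; apply Rle_lt_trans with (phi_pow true (4 * h - 2)); [now apply phi_pow_true_le|].
  pose proof phi_true_bounds.
  assert (Hphi2 : phi_pow true 2 <= phi_pow true (4 * h - 2)) by (apply phi_pow_true_le; lia).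
  pose proof (phi_pow_true_lt_1 (- (4 * h - 1)) ltac:(lia)).
  rewrite phi_pow_2 in Hphi2; rewrite (X_phi true).
  replace (4 * h - 1)%Z with ((4 * h - 2) + 1)%Z at 1 by lia; rewrite phi_pow_add, phi_pow_1; nra.
Qed.

Lemma X_lt_phi_pow : IZR X < phi_pow true (4 * h - 1).
Proof. rewrite (X_phi true); pose proof (phi_pow_true_pos (- (4 * h - 1))); lra. Qed.

Lemma X_gt : 2.6 < IZR X.
Proof.
  assert (Hphi2 := phi_pow_lt_X 2 ltac:(lia)); rewrite phi_pow_2 in Hphi2.
  pose proof phi_true_bounds; lra.
Qed.

Lemma Y_gt_1 : 1 < IZR Y.
Proof.
  assert (HY := root5_Y true); pose proof sqrt5_bounds; rewrite root5_true in HY.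
  pose proof (phi_pow_true_pos (- (4 * h - 1))); pose proof X_gt; nra.
Qed.

Lemma sigma_eps (s t : bool) : sigma p s t eps = IZR Y + sg t * sqrt (IZR p).
Proof. unfold eps; rewrite sigma_of_parts by exact p_pos; ring. Qed.

Lemma sigma_eta (s t : bool) : sigma p s t eta = IZR X + sg t * root5 s * sqrt (IZR p).
Proof. apply sigma_of_parts, p_pos. Qed.

Lemma root5_sigma_eps (s t : bool) :
  root5 s * sigma p s t eps = sigma p s t eta + 2 * phi_pow s (- (4 * h - 1)).
Proof. rewrite sigma_eps, sigma_eta, Rmult_plus_distr_l, root5_Y; ring. Qed.

Lemma eps_norm (s t : bool) : sigma p s t eps * sigma p s (negb t) eps = 1.
Proof.
  rewrite !sigma_eps; assert (Hsp := sqrt_p_sq p p_pos); assert (HY := Y_sq).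
  destruct t; simpl; ring [Hsp HY].
Qed.

Lemma eta_norm (s t : bool) : sigma p s t eta * sigma p s (negb t) eta = 1.
Proof.
  rewrite !sigma_eta; assert (Hsp := sqrt_p_sq p p_pos); assert (HX := X_sq).
  destruct t; simpl; ring [Hsp HX (root5_sq s)].
Qed.

Lemma eta_trace (s t : bool) : sigma p s t eta + sigma p s (negb t) eta = 2 * IZR X.
Proof. rewrite !sigma_eta; destruct t; simpl; ring. Qed.

Lemma tp_unit_eps : tp_unit p eps.
Proof.
  apply tp_unit_relative_norm_one.
  - apply in_OK_of_parts; [apply in_Zphi_IZR|apply (in_Zphi_IZR 1)].
  - intros s; unfold eps; rewrite base_part_of_parts; pose proof Y_gt_1; lra.
  - apply (sigma_ext p p_pos); intros s t.
    rewrite sigma_mul, sigma_conj, sigma_one by exact p_pos; apply eps_norm.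
Qed.

Lemma tp_unit_eta : tp_unit p eta.
Proof.
  apply tp_unit_relative_norm_one.
  - apply in_OK_of_parts; [apply in_Zphi_IZR|apply in_Zphi_root5].
  - intros s; unfold eta; rewrite base_part_of_parts; pose proof X_gt; lra.
  - apply (sigma_ext p p_pos); intros s t.
    rewrite sigma_mul, sigma_conj, sigma_one by exact p_pos; apply eta_norm.
Qed.

Lemma sigma_eta_pos (s t : bool) : 0 < sigma p s t eta.
Proof. apply tp_unit_eta. Qed.

Lemma ln_sigma_eps (s t : bool) : ln (sigma p s t eps) = sg t * ln (sigma p true true eps).
Proof.
  assert (Hnorm := eps_norm true true); simpl in Hnorm.
  pose proof (proj2 (proj2 tp_unit_eps) true true).
  pose proof (proj2 (proj2 tp_unit_eps) true false).
  apply (f_equal ln) in Hnorm; rewrite ln_mult, ln_1 in Hnorm by assumption.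
  replace (sigma p s t eps) with (sigma p true t eps) by (rewrite !sigma_eps; reflexivity).
  destruct t; simpl; lra.
Qed.

Lemma ln_sigma_eta (s t : bool) :
  ln (sigma p s t eta) = sg t * (sg s * ln (sigma p true true eta)).
Proof.
  assert (Hnorm := eta_norm true true); simpl in Hnorm.
  apply (f_equal ln) in Hnorm; rewrite ln_mult, ln_1 in Hnorm by apply sigma_eta_pos.
  replace (sigma p s t eta) with (sigma p true (if s then t else negb t) eta)
    by (rewrite !sigma_eta; unfold root5; destruct s, t; simpl; ring).
  destruct s, t; simpl; lra.
Qed.

Lemma ln_eps_pos : 0 < ln (sigma p true true eps).
Proof.
  rewrite <- ln_1; apply ln_increasing; [lra|rewrite sigma_eps; simpl].
  pose proof Y_gt_1; pose proof (sqrt_p_pos p p_pos); lra.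
Qed.

Lemma ln_eps_le_ln_eta : ln (sigma p true true eps) <= ln (sigma p true true eta).
Proof.
  apply ln_le_iff; [apply tp_unit_eps|apply sigma_eta_pos|].
  assert (Heps := root5_sigma_eps true true); rewrite root5_true in Heps.
  pose proof (phi_pow_true_lt_1 (- (4 * h - 1)) ltac:(lia)).
  assert (HX : IZR X < sigma p true true eta).
  { rewrite sigma_eta, root5_true; simpl.
    pose proof (sqrt_p_pos p p_pos); pose proof sqrt5_bounds; nra. }
  pose proof sqrt5_bounds; pose proof X_gt; nra.
Qed.

Lemma unit_reduction_family (a : el) :
  totpos p a -> exists b, assoc p a b /\ (in_cone eps b \/ in_cone eta b).
Proof.
  intros Ha; apply unit_reduction with (ln (sigma p true true eps)) (ln (sigma p true true eta));
    auto using tp_unit_eps, tp_unit_eta, ln_eps_pos, ln_eps_le_ln_eta, ln_sigma_eps, ln_sigma_eta.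
Qed.

Lemma indec_in_cone_eps (a : el) : indec p a -> in_cone eps a -> assoc p a el1.
Proof.
  intros Ha (l&m&Pl&Pm&E).
  destruct (proj1 (in_OK_iff_parts a) (proj1 (proj1 Ha))) as [Hb Hr].
  assert (parts : forall s, base_part a s = l s + m s * IZR Y /\ root_part a s = m s * 1).
  { intros s; destruct (parts_of_combination eps a l m E s) as [-> ->]; unfold eps.
    now rewrite base_part_of_parts, root_part_of_parts. }
  assert (Hm : in_Zphi m).
  { apply in_Zphi_ext with (2 := Hr); intros s; destruct (parts s); lra. }
  assert (Hl : in_Zphi l).
  { apply in_Zphi_ext with (fun s => base_part a s - root_part a s * IZR Y); [|auto with zphi].
    intros s; destruct (parts s) as [-> ->]; ring. }
  assert (coords : cone_coords eps a l m) by (split; [auto with zphi|split; auto with zphi]).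
  destruct (root5_multiple_sign l (proj1 coords) Pl) as [Zl|Ql];
    [destruct (root5_multiple_sign m (proj1 (proj2 coords)) Pm) as [Zm|Qm]|].
  - exfalso; assert (Hpos := proj2 (proj1 Ha) true true); rewrite E, Zl, Zm in Hpos; lra.
  - apply indec_cone_integral_m_assoc_one with eps l m; auto using tp_unit_eps.
  - apply indec_cone_integral_l_assoc_one with eps l m; auto; apply tp_unit_eps.
Qed.

Lemma cong_root5_X : cong_root5 (fun _ => IZR X) (-1).
Proof.
  apply cong_root5_ext with (fun s => phi_pow s (4 * h + -1) + IZR (-1) * phi_pow s (4 * - h + 1)).
  { intros s; rewrite (X_phi s).
    replace (4 * h + -1)%Z with (4 * h - 1)%Z by lia.
    replace (4 * - h + 1)%Z with (- (4 * h - 1))%Z by lia; ring. }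
  apply cong_root5_mod5 with (2 + -1 * 3)%Z; [now exists 0%Z|apply cong_root5_add].
  - apply cong_root5_phi_pow_shift, cong_root5_phi_pow_m1.
  - apply cong_root5_scaled_phi_pow with (1 := fun s => eq_refl).
    apply cong_root5_phi_pow_shift, cong_root5_phi_pow_1.
Qed.

Definition delta (i : Z) : el :=
  of_parts (fun s => tau s * (1 + phi_pow s (4 * i) * IZR X))
           (fun s => tau s * (phi_pow s (4 * i) * root5 s)).

Lemma sigma_delta (i : Z) (s t : bool) :
  sigma p s t (delta i) = tau s * (1 + phi_pow s (4 * i) * sigma p s t eta).
Proof. unfold delta; rewrite sigma_of_parts, sigma_eta by exact p_pos; ring. Qed.

Lemma in_OK_delta (i : Z) : in_OK p (delta i).
Proof.
  apply in_OK_of_parts.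
  - assert (Hcong : cong_root5 (fun s => phi_pow s (4 * i) * IZR X) (1 * -1))
      by (apply cong_root5_mul; [apply cong_root5_phi_pow_4|apply cong_root5_X]).
    apply in_Zphi_ext with (fun s =>
      phi_pow s (-1) * ((phi_pow s (4 * i) * IZR X - IZR (1 * -1)) / root5 s));
      [|auto with zphi].
    intros s; rewrite <- root5_tau; simpl; field; apply root5_neq_0.
  - apply in_Zphi_ext with (fun s => phi_pow s (-1) * phi_pow s (4 * i)); [|auto with zphi].
    intros s; rewrite <- root5_tau; ring.
Qed.

Lemma totpos_delta (i : Z) : totpos p (delta i).
Proof.
  split; [apply in_OK_delta|]; intros s t; rewrite sigma_delta.
  apply Rmult_lt_0_compat; [apply tau_pos|]; apply Rplus_lt_0_compat; [lra|].
  apply Rmult_lt_0_compat; [|apply sigma_eta_pos].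
  replace (4 * i)%Z with (2 * (2 * i))%Z by lia; apply phi_pow_even_pos.
Qed.

Lemma cone_coords_eta (a : el) (l m : bool -> R) :
  in_OK p a -> (forall s t, sigma p s t a = l s + m s * sigma p s t eta) ->
  cone_coords eta a l m /\ in_Zphi (fun s => l s - m s).
Proof.
  intros [Hb Hr]%in_OK_iff_parts E.
  assert (parts : forall s, base_part a s = l s + m s * IZR X /\ root_part a s = m s * root5 s).
  { intros s; destruct (parts_of_combination eta a l m E s) as [-> ->]; unfold eta.
    now rewrite base_part_of_parts, root_part_of_parts. }
  split; [split; [|split; [|assumption]]|].
  - apply in_Zphi_ext with (fun s => root5 s * base_part a s - IZR X * root_part a s);
      [|auto with zphi].
    intros s; destruct (parts s) as [-> ->]; ring.
  - apply in_Zphi_ext with (2 := Hr); intros s; destruct (parts s) as [_ ->]; ring.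
  - pose proof cong_root5_X; apply in_Zphi_ext with
      (fun s => base_part a s - root_part a s * ((IZR X - IZR (-1)) / root5 s)); [|auto with zphi].
    intros s; destruct (parts s) as [-> ->]; field; apply root5_neq_0.
Qed.

Lemma indec_interior_cone_eta (a : el) (l m : bool -> R) :
  indec p a -> cone_coords eta a l m -> in_Zphi (fun s => l s - m s) ->
  (forall s, 0 < l s) -> (forall s, 0 < m s) -> exists i, assoc p a (delta i).
Proof.
  intros Ha Hc Hlm Pl Pm; pose proof Hc as (Hl&Hm&_).
  assert (Htau : forall z, in_Zphi (fun s => root5 s * z s) ->
    in_Zphi (fun s => root5 s * phi s * z s)).
  { intros z Hz; apply in_Zphi_ext with (fun s => phi s * (root5 s * z s)); [intros; ring|].
    auto with zphi. }
  assert (Ptau : forall z : bool -> R, (forall s, 0 < z s) -> forall s, 0 < root5 s * phi s * z s).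
  { intros z Hz s; apply Rmult_lt_reg_l with (tau s); [apply tau_pos|].
    rewrite Rmult_0_r, <- div_tau; apply Hz. }
  destruct (congruent_units_below (fun s => root5 s * phi s * l s) (fun s => root5 s * phi s * m s))
    as (k&i&Hk&Hi); auto.
  { apply in_Zphi_ext with (fun s => phi s * (l s - m s)); [|auto with zphi].
    intros s; field; apply root5_neq_0. }
  exists i, (phi_unit k); split; [apply tp_unit_phi_unit|].
  apply (indec_cone_eq eta a _ l m
    (fun s => tau s * phi_pow s (2 * k)) (fun s => tau s * phi_pow s (2 * k + 4 * i)));
    try assumption.
  - apply tp_unit_eta.
  - apply totpos_mul; [apply tp_unit_phi_unit|apply totpos_delta].
  - split; [|split]; [apply in_Zphi_root5_tau; auto with zphi..|].
    intros s t; rewrite sigma_mul, sigma_phi_unit, sigma_delta, phi_pow_add by exact p_pos; ring.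
  - intros s; rewrite (div_tau (l s) s); apply Rmult_le_compat_l; [left; apply tau_pos|apply Hk].
  - intros s; rewrite (div_tau (m s) s); apply Rmult_le_compat_l; [left; apply tau_pos|apply Hi].
Qed.

Lemma indec_in_cone_eta (a : el) :
  indec p a -> in_cone eta a -> assoc p a el1 \/ exists i, assoc p a (delta i).
Proof.
  intros Ha (l&m&Pl&Pm&E).
  destruct (cone_coords_eta a l m (proj1 (proj1 Ha)) E) as [Hc Hlm].
  pose proof Hc as (Hl&Hm&_).
  destruct (root5_multiple_sign l Hl Pl) as [Zl|Ql], (root5_multiple_sign m Hm Pm) as [Zm|Qm].
  - exfalso; assert (H := proj2 (proj1 Ha) true true); rewrite E, Zl, Zm in H; lra.
  - left; apply indec_cone_integral_m_assoc_one with eta l m; try assumption; [apply tp_unit_eta|].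
    apply in_Zphi_ext with (fun s => - (l s - m s)); [intros s; rewrite Zl; ring|].
    now apply in_Zphi_opp.
  - left; apply indec_cone_integral_l_assoc_one with eta l m; try assumption; [apply tp_unit_eta|].
    apply in_Zphi_ext with (fun s => l s - m s); [intros s; rewrite Zm; ring|assumption].
  - right; now apply indec_interior_cone_eta with l m.
Qed.

Lemma indec_one_or_delta (a : el) : indec p a -> assoc p a el1 \/ exists i, assoc p a (delta i).
Proof.
  intros Ha; destruct (unit_reduction_family a (proj1 Ha)) as (b&Hab&Hcone).
  assert (Hb : indec p b) by (apply indec_assoc with a; [now apply assoc_sym|assumption]).
  destruct Hcone as [Hcone|Hcone].
  - left; apply assoc_trans with b; [assumption|now apply indec_in_cone_eps].
  - destruct (indec_in_cone_eta b Hb Hcone) as [H|(i&H)]; [left|right; exists i];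
      now apply assoc_trans with b.
Qed.

Lemma delta_opp (i : Z) :
  delta (- i) = elmul p (elmul p (phi_unit (- (2 * i))) eta) (elconj true false (delta i)).
Proof.
  apply (sigma_ext p p_pos); intros s t.
  rewrite !sigma_mul, sigma_phi_unit, sigma_conj, !sigma_delta by exact p_pos.
  replace (4 * - i)%Z with (- (4 * i))%Z by lia.
  replace (2 * - (2 * i))%Z with (- (4 * i))%Z by lia.
  assert (Hinv := phi_pow_opp_r s (4 * i)); assert (Hnorm := eta_norm s t); ring [Hinv Hnorm].
Qed.

Lemma delta_opp_assoc_conj (i : Z) : assoc p (delta (- i)) (elconj true false (delta i)).
Proof.
  rewrite delta_opp; eexists; split; [|reflexivity].
  apply tp_unit_mul; [apply tp_unit_phi_unit|apply tp_unit_eta].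
Qed.

Lemma indec_delta_opp (i : Z) : indec p (delta i) -> indec p (delta (- i)).
Proof.
  intros H; apply indec_assoc with (elconj true false (delta i)).
  - apply delta_opp_assoc_conj.
  - now apply indec_conj.
Qed.

(** * Indecomposability of [delta i] *)

Lemma phi_pow_even_lt_X (s : bool) (k : Z) : (Z.abs k <= 2 * h - 1)%Z -> phi_pow s (2 * k) < IZR X.
Proof.
  intros Hk; destruct s; [|rewrite phi_pow_false_even]; apply phi_pow_lt_X; lia.
Qed.

Lemma phi_pow_between_eta (s : bool) (k : Z) : (Z.abs k <= 2 * h - 1)%Z ->
  (phi_pow s (2 * k) - sigma p s true eta) * (phi_pow s (2 * k) - sigma p s false eta) < 0.
Proof.
  intros Hk.
  assert (Hnorm := eta_norm s true); assert (Htrace := eta_trace s true); simpl in Hnorm, Htrace.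
  assert (Hinv := phi_pow_opp_r s (2 * k)); pose proof (phi_pow_even_pos s k).
  pose proof (phi_pow_even_lt_X s k Hk).
  assert (Hlt := phi_pow_even_lt_X s (- k) ltac:(lia)).
  replace (2 * - k)%Z with (- (2 * k))%Z in Hlt by lia.
  replace (_ * _) with (phi_pow s (2 * k) * (phi_pow s (2 * k) + phi_pow s (- (2 * k)) - 2 * IZR X))
    by (rewrite <- Htrace; ring [Hinv Hnorm]).
  nra.
Qed.

(* In the coordinates [a = l + m eta] this is the trace to [Q] of
   [(phi / sqrt 5) (l + phi^(2-4i) m)]; it takes positive integral values because
   [phi^(2-4i)] is [X] modulo [sqrt 5] and lies between [eta] and its conjugate. *)
Definition trace_form (i : Z) (a : el) : R :=
  let z s := phi s / root5 s *
    (base_part a s + (phi_pow s (2 * (1 - 2 * i)) - IZR X) / root5 s * root_part a s)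
  in z true + z false.

Lemma trace_form_add (i : Z) (a b : el) :
  trace_form i (eladd a b) = trace_form i a + trace_form i b.
Proof. unfold trace_form, base_part, root_part; simpl; field; split; apply root5_neq_0. Qed.

Lemma trace_form_isZ (i : Z) (a : el) : in_OK p a -> isZ (trace_form i a).
Proof.
  intros [Hb Hr]%in_OK_iff_parts.
  assert (Hcong : in_Zphi (fun s => (phi_pow s (2 * (1 - 2 * i)) - IZR X) / root5 s)).
  { assert (Hphi := cong_root5_phi_pow_shift (- i) 2 (-1) cong_root5_phi_pow_2).
    pose proof cong_root5_X.
    replace (4 * - i + 2)%Z with (2 * (1 - 2 * i))%Z in Hphi by lia.
    apply in_Zphi_ext with (fun s => (phi_pow s (2 * (1 - 2 * i)) - IZR (-1)) / root5 s
      - (IZR X - IZR (-1)) / root5 s); [|now apply in_Zphi_sub].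
    intros s; field; apply root5_neq_0. }
  unfold trace_form; replace (_ + _) with
    (let z s := phi s *
       (base_part a s + (phi_pow s (2 * (1 - 2 * i)) - IZR X) / root5 s * root_part a s)
     in z true / root5 true + z false / root5 false)
    by (simpl; field; split; apply root5_neq_0).
  apply in_Zphi_trace_isZ; auto with zphi.
Qed.

Lemma trace_form_pos (i : Z) (a : el) :
  (1 - h <= i <= h)%Z -> totpos p a -> 0 < trace_form i a.
Proof.
  intros Hi [_ Ha].
  assert (Hplace : forall s, 0 < base_part a s +
    (phi_pow s (2 * (1 - 2 * i)) - IZR X) / root5 s * root_part a s).
  { intros s; pose proof (root5_neq_0 s).
    set (m := root_part a s / root5 s); set (l := base_part a s - m * IZR X).
    assert (Hcone : forall t, sigma p s t a = l + m * sigma p s t eta)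
      by (intros t; rewrite sigma_eta, sigma_parts by exact p_pos; unfold l, m; field; assumption).
    replace (_ + _) with (l + m * phi_pow s (2 * (1 - 2 * i))) by (unfold l, m; field; assumption).
    apply affine_pos_between with (sigma p s true eta) (sigma p s false eta);
      [apply phi_pow_between_eta; lia|rewrite <- Hcone; apply Ha..]. }
  apply Rplus_lt_0_compat; (apply Rmult_lt_0_compat; [apply phi_div_root5_pos|apply Hplace]).
Qed.

Lemma trace_form_delta (i : Z) : trace_form i (delta i) = 1.
Proof.
  assert (Hplace : forall s, phi s / root5 s * (base_part (delta i) s +
    (phi_pow s (2 * (1 - 2 * i)) - IZR X) / root5 s * root_part (delta i) s) = phi s / root5 s).
  { intros s; unfold delta; rewrite base_part_of_parts, root_part_of_parts.
    replace (2 * (1 - 2 * i))%Z with (- (4 * i) + 2)%Z by lia; rewrite phi_pow_add, phi_pow_2.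
    assert (Hinv := phi_pow_opp_r s (4 * i)); pose proof (root5_neq_0 s); pose proof (phi_neq_0 s).
    set (q := phi_pow s (4 * i)) in *; set (q' := phi_pow s (- (4 * i))) in *.
    transitivity (phi s / root5 s * (tau s * (1 + q * q' * (phi s + 1)))); [field; assumption|].
    rewrite Hinv; unfold tau; replace (1 + 1 * (phi s + 1)) with (root5 s * phi s)
      by (rewrite root5_mul_phi; ring).
    field; split; assumption. }
  assert (Htrue := root5_phi true); rewrite root5_true in Htrue; pose proof sqrt5_bounds.
  unfold trace_form; rewrite !Hplace, phi_false, root5_false, root5_true.
  field_simplify_eq; [rewrite Htrue; ring|lra].
Qed.

Lemma indec_delta (i : Z) : (Z.abs i <= h)%Z -> indec p (delta i).
Proof.
  assert (Hrange : forall j, (1 - h <= j <= h)%Z -> indec p (delta j)).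
  { intros j Hj; split; [apply totpos_delta|]; intros (b&c&Hb&Hc&E).
    assert (Hge1 : forall a, totpos p a -> 1 <= trace_form j a)
      by (intros a Ha; apply isZ_pos_ge_1; [apply trace_form_isZ, Ha|now apply trace_form_pos]).
    assert (Htrace := trace_form_delta j); rewrite E, trace_form_add in Htrace.
    pose proof (Hge1 b Hb); pose proof (Hge1 c Hc); lra. }
  intros Hi; destruct (Z.eq_dec i (- h)) as [->|]; [|apply Hrange; lia].
  apply indec_delta_opp, Hrange; lia.
Qed.

Lemma root5_delta_sub (i : Z) (s t : bool) :
  root5 s * sigma p s t (elsub (delta i) (elmul p (phi_unit (2 * h)) eps)) =
  (phi_pow s (4 * i - 1) - phi_pow s (4 * h)) * sigma p s t eta - phi_pow s 2.
Proof.
  rewrite sigma_sub, sigma_mul, sigma_phi_unit, sigma_delta by exact p_pos.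
  replace (2 * (2 * h))%Z with (4 * h)%Z by lia.
  transitivity ((root5 s * tau s) * (1 + phi_pow s (4 * i) * sigma p s t eta) -
    phi_pow s (4 * h) * (root5 s * sigma p s t eps)); [ring|].
  rewrite root5_tau, root5_sigma_eps; replace (4 * i - 1)%Z with (4 * i + -1)%Z by lia.
  replace (phi_pow s (- (4 * h - 1))) with (phi_pow s (- (4 * h)) * phi s)
    by (rewrite <- phi_pow_1, <- phi_pow_add; f_equal; lia).
  rewrite phi_pow_add, phi_pow_m1, phi_pow_2.
  assert (Hinv := phi_pow_opp_r s (4 * h)); ring [Hinv].
Qed.

Lemma totpos_delta_sub (i : Z) :
  (h < i)%Z -> totpos p (elsub (delta i) (elmul p (phi_unit (2 * h)) eps)).
Proof.
  intros Hi; split.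
  { apply in_OK_sub; [apply in_OK_delta|].
    apply in_OK_mul; [apply tp_unit_phi_unit|apply tp_unit_eps]. }
  intros s t; assert (Hd5 := root5_delta_sub i s t).
  set (d := sigma p s t _) in *; pose proof (sigma_eta_pos s t).
  destruct s.
  - assert (Hgrow : phi_pow true (4 * h - 1) * phi_pow true 4 <= phi_pow true (4 * i - 1))
      by (rewrite <- phi_pow_add; apply phi_pow_true_le; lia).
    replace (4 * h)%Z with ((4 * h - 1) + 1)%Z in Hd5 at 1 by lia.
    rewrite phi_pow_add, phi_pow_1, phi_pow_2 in Hd5; rewrite phi_pow_4 in Hgrow.
    assert (HW : 1 < 2 * (phi_pow true (4 * h - 1) * sigma p true t eta)).
    { pose proof (eta_norm true t); assert (Htrace := eta_trace true t); pose proof X_lt_phi_pow.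
      assert (1 < 2 * IZR X * sigma p true t eta) by (rewrite <- Htrace; nra).
      nra. }
    pose proof phi_true_bounds; rewrite root5_true in Hd5; pose proof sqrt5_bounds.
    set (q := phi_pow true (4 * h - 1)) in *; set (w := sigma p true t eta) in *.
    assert (Hd : 0 < sqrt 5 * d) by (rewrite Hd5; nra).
    nra.
  - pose proof phi_false_bounds; pose proof sqrt5_bounds.
    rewrite root5_false in Hd5.
    replace (4 * i - 1)%Z with (2 * (2 * i) + -1)%Z in Hd5 by lia.
    replace (4 * h)%Z with (2 * (2 * h))%Z in Hd5 by lia.
    rewrite phi_pow_add, phi_pow_m1, phi_pow_2 in Hd5.
    pose proof (phi_pow_even_pos false (2 * i)); pose proof (phi_pow_even_pos false (2 * h)).
    assert (Hneg : phi_pow false (2 * (2 * i)) * (phi false - 1) - phi_pow false (2 * (2 * h)) < 0)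
      by nra.
    nra.
Qed.

Lemma indec_delta_bound (i : Z) : indec p (delta i) -> (Z.abs i <= h)%Z.
Proof.
  assert (Hlarge : forall j, (h < j)%Z -> ~ indec p (delta j)).
  { intros j Hj [_ Hindec]; apply Hindec.
    exists (elmul p (phi_unit (2 * h)) eps), (elsub (delta j) (elmul p (phi_unit (2 * h)) eps)).
    split; [apply totpos_mul; [apply tp_unit_phi_unit|apply tp_unit_eps]|].
    split; [now apply totpos_delta_sub|ring]. }
  intros Hi; destruct (Z_le_gt_dec (Z.abs i) h) as [|Hgt]; [assumption|exfalso].
  destruct (Z_le_gt_dec 0 i).
  - apply (Hlarge i); [lia|assumption].
  - apply (Hlarge (- i)%Z); [lia|now apply indec_delta_opp].
Qed.

(** * Association between the [delta i] *)

Lemma delta_h_eq : delta h = elmul p (elmul p (phi_unit (2 * h)) eps) (delta (- h)).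
Proof.
  apply (sigma_ext p p_pos); intros s t.
  rewrite !sigma_mul, sigma_phi_unit, !sigma_delta by exact p_pos.
  apply Rmult_eq_reg_l with (root5 s); [|apply root5_neq_0].
  transitivity (phi_pow s (2 * (2 * h)) * (root5 s * sigma p s t eps) *
    (tau s * (1 + phi_pow s (4 * - h) * sigma p s t eta))); [rewrite root5_sigma_eps|ring].
  replace (2 * (2 * h))%Z with ((4 * h - 1) + 1)%Z by lia.
  replace (4 * - h)%Z with (- (4 * h - 1) + -1)%Z by lia.
  replace (4 * h)%Z with ((4 * h - 1) + 1)%Z at 1 by lia.
  rewrite !phi_pow_add, phi_pow_1, phi_pow_m1, root5_phi.
  assert (Htrace := eta_trace s t); assert (HX := X_phi s); rewrite HX in Htrace.
  assert (Hnorm := eta_norm s t); assert (Hinv := phi_pow_opp_r s (4 * h - 1)).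
  set (q := phi_pow s (4 * h - 1)) in *; set (q' := phi_pow s (- (4 * h - 1))) in *.
  set (w := sigma p s t eta) in *.
  assert (Hww : w * w = 2 * (q - q') * w - 1) by (rewrite <- Htrace, <- Hnorm; ring).
  ring [Hww Hinv (phi_sq s)].
Qed.

Lemma delta_h_assoc : assoc p (delta h) (delta (- h)).
Proof.
  rewrite delta_h_eq; eexists; split; [|reflexivity].
  apply tp_unit_mul; [apply tp_unit_phi_unit|apply tp_unit_eps].
Qed.

Lemma elnorm_delta (i : Z) :
  elnorm p (delta i) = (phi_pow true (4 * i) + phi_pow true (- (4 * i)) + 2 * IZR X) ^ 2 / 25.
Proof.
  assert (Hplace : forall s, sigma p s true (delta i) * sigma p s false (delta i) =
    tau s * tau s * phi_pow s (4 * i) * (phi_pow s (4 * i) + phi_pow s (- (4 * i)) + 2 * IZR X)).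
  { intros s.
    assert (Hnorm := eta_norm s true); assert (Htrace := eta_trace s true); simpl in Hnorm, Htrace.
    rewrite !sigma_delta, <- Htrace; assert (Hinv := phi_pow_opp_r s (4 * i)); ring [Hnorm Hinv]. }
  unfold elnorm; rewrite !Hplace.
  replace (- (4 * i))%Z with (4 * - i)%Z by lia; rewrite !phi_pow_false_4.
  replace (4 * - i)%Z with (- (4 * i))%Z by lia; rewrite Z.opp_involutive.
  assert (Hinv := phi_pow_opp_r true (4 * i)); assert (Hnorm := tau_norm).
  set (q := phi_pow true (4 * i)) in *; set (q' := phi_pow true (- (4 * i))) in *.
  transitivity ((tau true * tau false) ^ 2 * (q * q') * (q + q' + 2 * IZR X) ^ 2); [ring|].
  rewrite Hnorm, Hinv; field.
Qed.

Lemma one_not_assoc_delta (i : Z) : ~ assoc p el1 (delta i).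
Proof.
  intros H; apply elnorm_assoc in H; rewrite elnorm_delta, elnorm_one in H.
  pose proof (phi_pow_true_pos (4 * i)); pose proof (phi_pow_true_pos (- (4 * i))).
  pose proof X_gt; nra.
Qed.

Lemma delta_assoc_abs (i j : Z) : assoc p (delta i) (delta j) -> i = j \/ i = (- j)%Z.
Proof.
  intros H; apply elnorm_assoc in H; rewrite !elnorm_delta in H.
  assert (Hinvi := phi_pow_opp_r true (4 * i)); assert (Hinvj := phi_pow_opp_r true (4 * j)).
  pose proof (phi_pow_true_pos (4 * i)); pose proof (phi_pow_true_pos (- (4 * i))).
  pose proof (phi_pow_true_pos (4 * j)); pose proof (phi_pow_true_pos (- (4 * j))).
  pose proof X_gt.
  assert (Hprod : (phi_pow true (4 * i) - phi_pow true (4 * j)) *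
    (phi_pow true (4 * i) - phi_pow true (- (4 * j))) = 0).
  { assert (Sum : phi_pow true (4 * i) + phi_pow true (- (4 * i)) =
      phi_pow true (4 * j) + phi_pow true (- (4 * j))) by nra.
    transitivity (phi_pow true (4 * i) * (phi_pow true (4 * i) -
      (phi_pow true (4 * j) + phi_pow true (- (4 * j)))) + 1); [ring [Hinvj]|].
    rewrite <- Sum; ring [Hinvi]. }
  apply Rmult_integral in Hprod; destruct Hprod as [Hprod|Hprod]; [left|right];
    apply Rminus_diag_uniq, phi_pow_true_inj in Hprod; lia.
Qed.

(* If [delta i = e * delta (- i)] then [f = phi^(-4i) e] satisfies
   [f (phi^(4i) + eta) = 1 + phi^(4i) eta], which determines its coefficient of [sqrt p]. *)
Lemma delta_opp_quotient_root_part (i : Z) (e : el) (s : bool) :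
  delta i = elmul p e (delta (- i)) ->
  root_part (elmul p e (phi_unit (- (2 * i)))) s *
    (phi_pow s (4 * i) * phi_pow s (4 * i) + 2 * IZR X * phi_pow s (4 * i) + 1) =
  root5 s * (phi_pow s (4 * i) * phi_pow s (4 * i) - 1).
Proof.
  intros E; set (f := elmul p e (phi_unit (- (2 * i)))).
  assert (Ef : forall t, sigma p s t f * (phi_pow s (4 * i) + sigma p s t eta) =
    1 + phi_pow s (4 * i) * sigma p s t eta).
  { intros t; apply (f_equal (sigma p s t)) in E; unfold f.
    rewrite sigma_mul, !sigma_delta in E by exact p_pos.
    rewrite sigma_mul, sigma_phi_unit by exact p_pos.
    replace (4 * - i)%Z with (- (4 * i))%Z in E by lia.
    replace (2 * - (2 * i))%Z with (- (4 * i))%Z by lia.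
    apply Rmult_eq_reg_l with (tau s); [rewrite E|pose proof (tau_pos s); lra].
    assert (Hinv := phi_pow_opp_r s (4 * i)); ring [Hinv]. }
  assert (Eplus := Ef true); assert (Eminus := Ef false).
  assert (Hnorm := eta_norm s true); assert (Htrace := eta_trace s true); simpl in Hnorm, Htrace.
  assert (Heta : sigma p s true eta - sigma p s false eta = 2 * sqrt (IZR p) * root5 s)
    by (rewrite !sigma_eta; simpl; ring).
  assert (Hfdiff : sigma p s true f - sigma p s false f = 2 * sqrt (IZR p) * root_part f s)
    by (rewrite !sigma_parts by exact p_pos; simpl; ring).
  pose proof (sqrt_p_pos p p_pos); rewrite <- Htrace.
  set (q := phi_pow s (4 * i)) in *; set (w := sigma p s true eta) in *.
  set (w' := sigma p s false eta) in *.
  apply Rmult_eq_reg_l with (2 * sqrt (IZR p)); [|lra].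
  transitivity ((sigma p s true f - sigma p s false f) * ((q + w) * (q + w')));
    [rewrite Hfdiff; ring [Hnorm]|].
  transitivity ((sigma p s true f * (q + w)) * (q + w') - (sigma p s false f * (q + w')) * (q + w));
    [ring|].
  rewrite Eplus, Eminus; transitivity ((q * q - 1) * (w - w')); [ring|rewrite Heta; ring].
Qed.

(* The coefficient above takes the same value at both places, strictly between 0 and 1. *)
Lemma delta_not_assoc_opp (i : Z) : (0 < i < h)%Z -> ~ assoc p (delta i) (delta (- i)).
Proof.
  intros Hi (e&He&E).
  set (f := elmul p e (phi_unit (- (2 * i)))).
  assert (Hf : in_OK p f) by (apply in_OK_mul; [apply He|apply tp_unit_phi_unit]).
  apply in_OK_iff_parts in Hf; destruct Hf as [_ Hf].
  assert (Vtrue := delta_opp_quotient_root_part i e true E).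
  assert (Vfalse := delta_opp_quotient_root_part i e false E); fold f in Vtrue, Vfalse.
  rewrite phi_pow_false_4, root5_false in Vfalse; rewrite root5_true in Vtrue.
  assert (Hinv := phi_pow_opp_r true (4 * i)); pose proof X_gt; pose proof sqrt5_bounds.
  assert (Hq1 : 1 < phi_pow true (4 * i))
    by (rewrite <- (phi_pow_0 true); apply phi_pow_true_lt; lia).
  assert (HqX : phi_pow true (4 * i) * phi_pow true 2 < IZR X)
    by (rewrite <- phi_pow_add; apply phi_pow_lt_X; lia).
  rewrite phi_pow_2 in HqX; pose proof phi_true_bounds.
  set (q := phi_pow true (4 * i)) in *; set (q' := phi_pow true (- (4 * i))) in *.
  set (d := q * q + 2 * IZR X * q + 1) in *.
  assert (Hd : sqrt 5 * (q * q - 1) < d) by (unfold d; nra).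
  assert (Vfalse' : root_part f false * d = sqrt 5 * (q * q - 1)).
  { transitivity (q * q * (root_part f false * (q' * q' + 2 * IZR X * q' + 1)));
      [unfold d; ring [Hinv]|rewrite Vfalse; ring [Hinv]]. }
  assert (Hd0 : 0 < d) by (unfold d; nra).
  assert (Hn : 0 < sqrt 5 * (q * q - 1)) by (apply Rmult_lt_0_compat; nra).
  assert (Htrue01 : 0 < root_part f true < 1) by nra.
  assert (Hfalse01 : 0 < root_part f false < 1) by nra.
  assert (Hnorm : 1 <= root_part f true * root_part f false)
    by (apply in_Zphi_pos_norm; [assumption|intros []; [apply Htrue01|apply Hfalse01]]).
  nra.
Qed.

Lemma delta_assoc_inj (i j : Z) :
  (- h <= i < h)%Z -> (- h <= j < h)%Z -> assoc p (delta i) (delta j) -> i = j.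
Proof.
  intros Hi Hj Hassoc; destruct (delta_assoc_abs i j Hassoc) as [Hij|Hij]; [assumption|].
  destruct (Z.lt_trichotomy i 0) as [L|[L|L]]; [|lia|]; exfalso.
  - apply (delta_not_assoc_opp j); [lia|].
    rewrite <- Hij; now apply assoc_sym.
  - apply (delta_not_assoc_opp i); [lia|].
    replace (- i)%Z with j by lia; assumption.
Qed.

(* [rho] comes from [delta (- h)], [gamma_(2i)] from [delta i] and [gamma_(2i+1)] from
   [delta (- i)]; position [k >= 2] of the list holds [gamma_(k-1)]. *)
Definition delta_index (k : nat) : Z :=
  if Nat.eqb k 1 then - h
  else if Nat.odd k then Z.of_nat (Nat.div2 k) else 1 - Z.of_nat (Nat.div2 k).

Definition family_rep (k : nat) : el := match k with O => el1 | _ => delta (delta_index k) end.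

Lemma delta_index_even (i : nat) : delta_index (2 * i) = (1 - Z.of_nat i)%Z.
Proof.
  unfold delta_index; replace (Nat.eqb (2 * i) 1) with false
    by (symmetry; apply Nat.eqb_neq; lia).
  now rewrite Nat.odd_even, Nat.div2_double.
Qed.

Lemma delta_index_odd (i : nat) : (1 <= i)%nat -> delta_index (2 * i + 1) = Z.of_nat i.
Proof.
  intros Hi; unfold delta_index; replace (Nat.eqb (2 * i + 1) 1) with false
    by (symmetry; apply Nat.eqb_neq; lia).
  now rewrite Nat.odd_odd, Nat.add_1_r, Nat.div2_succ_double.
Qed.

Lemma delta_index_cases (k : nat) : (1 <= k)%nat ->
  (k = 1%nat /\ delta_index k = (- h)%Z) \/
  (exists i, (1 <= i)%nat /\ k = (2 * i)%nat /\ delta_index k = (1 - Z.of_nat i)%Z) \/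
  (exists i, (1 <= i)%nat /\ k = (2 * i + 1)%nat /\ delta_index k = Z.of_nat i).
Proof.
  intros Hk; destruct (Nat.eq_dec k 1) as [->|Hk1]; [now left|right].
  destruct (Nat.Even_or_Odd k) as [[i ->]|[i ->]]; [left|right]; exists i;
    (split; [lia|split; [reflexivity|]]).
  - apply delta_index_even.
  - apply delta_index_odd; lia.
Qed.

Lemma delta_index_bounds (k : nat) :
  (1 <= k)%nat -> (Z.of_nat k < 2 * h + 1)%Z -> (- h <= delta_index k < h)%Z.
Proof.
  intros Hk Hkh; destruct (delta_index_cases k Hk) as [[-> ->]|[(i&Hi&->&->)|(i&Hi&->&->)]]; lia.
Qed.

Lemma delta_index_inj (k l : nat) : (1 <= k)%nat -> (Z.of_nat k < 2 * h + 1)%Z ->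
  (1 <= l)%nat -> (Z.of_nat l < 2 * h + 1)%Z -> delta_index k = delta_index l -> k = l.
Proof.
  intros Hk Hkh Hl Hlh.
  destruct (delta_index_cases k Hk) as [[-> ->]|[(i&Hi&->&->)|(i&Hi&->&->)]],
    (delta_index_cases l Hl) as [[-> ->]|[(j&Hj&->&->)|(j&Hj&->&->)]]; lia.
Qed.

Lemma delta_index_surj (i : Z) : (- h <= i < h)%Z ->
  exists k, (1 <= k)%nat /\ (Z.of_nat k < 2 * h + 1)%Z /\ delta_index k = i.
Proof.
  intros Hi; destruct (Z.eq_dec i (- h)) as [->|Hne]; [|destruct (Z_le_gt_dec 1 i)].
  - exists 1%nat; split; [lia|split; [lia|reflexivity]].
  - exists (2 * Z.to_nat i + 1)%nat; rewrite delta_index_odd by lia; lia.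
  - exists (2 * Z.to_nat (1 - i))%nat; rewrite delta_index_even; lia.
Qed.

Lemma indec_assoc_family_rep (a : el) : indec p a ->
  exists k, (k < Z.to_nat (2 * h + 1))%nat /\ assoc p a (family_rep k).
Proof.
  intros Ha; destruct (indec_one_or_delta a Ha) as [H|(i&H)]; [exists 0%nat; split; [lia|exact H]|].
  assert (Hi : (Z.abs i <= h)%Z)
    by (apply indec_delta_bound, indec_assoc with a; [now apply assoc_sym|assumption]).
  assert (Hj : exists j, (- h <= j < h)%Z /\ assoc p a (delta j)).
  { destruct (Z.eq_dec i h) as [->|]; [|exists i; split; [lia|assumption]].
    exists (- h)%Z; split; [lia|].
    apply assoc_trans with (delta h); [assumption|apply delta_h_assoc]. }
  destruct Hj as (j&Hj&Haj), (delta_index_surj j Hj) as (k&Hk1&Hk2&<-).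
  exists k; split; [lia|]; destruct k; [lia|exact Haj].
Qed.

Lemma complete_reps_family : complete_reps p (Z.to_nat (2 * h + 1)) family_rep.
Proof.
  split; [|split; [|exact indec_assoc_family_rep]].
  - intros [|k] Hk; [apply indec_one|apply indec_delta].
    pose proof (delta_index_bounds (S k)); lia.
  - intros [|k] [|l] Hk Hl Hkl H; [lia|now apply one_not_assoc_delta in H| |].
    + apply assoc_sym in H; now apply one_not_assoc_delta in H.
    + apply Hkl, delta_index_inj; try lia.
      apply delta_assoc_inj; [apply delta_index_bounds; lia..|exact H].
Qed.

(** * The elements [rho] and [gamma_j] *)

Lemma rho_eq_delta :
  El ((IZR X + IZR Y) / 2) 0 (- 1 / 2) (1 / 2) = elmul p (phi_unit (2 * h)) (delta (- h)).
Proof.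
  apply parts_ext; intros s.
  - rewrite base_part_phi_unit_mul; unfold delta; rewrite base_part_of_parts.
    replace (2 * (2 * h))%Z with ((4 * h - 1) + 1)%Z by lia.
    replace (4 * - h)%Z with (- (4 * h - 1) + -1)%Z by lia.
    rewrite !phi_pow_add, phi_pow_1, phi_pow_m1; unfold base_part; simpl e0; simpl e1.
    assert (Hinv := phi_pow_opp_r s (4 * h - 1)); assert (HY := root5_Y s); assert (HX := X_phi s).
    set (q := phi_pow s (4 * h - 1)) in *; set (q' := phi_pow s (- (4 * h - 1))) in *.
    apply Rmult_eq_reg_l with (root5 s * phi s); [|apply root5_mul_phi_neq_0].
    transitivity (q * phi s * (1 + q' * (phi s - 1) * IZR X)).
    + transitivity (phi s * (root5 s * IZR X + root5 s * IZR Y) / 2); [field|].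
      rewrite HY, root5_phi, HX; field_simplify_eq; ring [Hinv (phi_sq s)].
    + unfold tau; field; auto using root5_neq_0, phi_neq_0.
  - rewrite root_part_phi_unit_mul; unfold delta; rewrite root_part_of_parts.
    unfold root_part; simpl e2; simpl e3.
    replace (2 * (2 * h))%Z with (4 * h)%Z by lia; replace (4 * - h)%Z with (- (4 * h))%Z by lia.
    transitivity (phi_pow s (4 * h) * phi_pow s (- (4 * h)) * / phi s).
    + rewrite phi_pow_opp_r, phi_inv, root5_phi; field.
    + unfold tau; field; auto using root5_neq_0, phi_neq_0.
Qed.

(* [gamma_j] for [c = (-1)^j] and [x + y sqrt 5 = 2 phi^(2j-1)] *)
Definition gamma_el (c x y : R) : el :=
  El ((y * IZR X + 1) / 2) ((x * IZR X - c) / 10) (c * x / 2) (c * y / 2).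

Lemma base_part_gamma_el (c x y : R) (k : Z) (s : bool) :
  x + y * root5 s = 2 * phi_pow s k ->
  base_part (gamma_el c x y) s = (2 * phi_pow s k * IZR X + root5 s - c) / (2 * root5 s).
Proof.
  intros E; unfold base_part; simpl; pose proof (root5_neq_0 s).
  rewrite <- E; field_simplify_eq; [ring [(root5_sq s)]|assumption].
Qed.

Lemma root_part_gamma_el (c x y : R) (k : Z) (s : bool) :
  x + y * root5 s = 2 * phi_pow s k -> root_part (gamma_el c x y) s = c * phi_pow s k.
Proof. intros E; unfold root_part; simpl; transitivity (c * (x + y * root5 s) / 2);
  [field|rewrite E; field]. Qed.

Lemma gamma_even (x y : R) (i : Z) :
  (forall s, x + y * root5 s = 2 * phi_pow s (4 * i - 1)) -> gamma_el 1 x y = delta i.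
Proof.
  intros E; apply parts_ext; intros s; unfold delta.
  - rewrite (base_part_gamma_el _ _ _ _ _ (E s)), base_part_of_parts.
    replace (4 * i)%Z with ((4 * i - 1) + 1)%Z at 2 by lia; rewrite phi_pow_add, phi_pow_1.
    unfold tau; field_simplify_eq; [|auto using root5_neq_0, phi_neq_0].
    rewrite root5_phi; ring [(phi_sq s)].
  - rewrite (root_part_gamma_el _ _ _ _ _ (E s)), root_part_of_parts.
    replace (4 * i)%Z with ((4 * i - 1) + 1)%Z at 2 by lia; rewrite phi_pow_add, phi_pow_1.
    unfold tau; field; auto using root5_neq_0, phi_neq_0.
Qed.

Lemma gamma_odd (x y : R) (i : Z) :
  (forall s, x + y * root5 s = 2 * phi_pow s (4 * i + 1)) ->
  gamma_el (-1) x y = elmul p (phi_unit 1) (elconj true false (delta i)).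
Proof.
  intros E; apply parts_ext; intros s.
  - rewrite (base_part_gamma_el _ _ _ _ _ (E s)), base_part_phi_unit_mul, base_part_conj.
    unfold delta; rewrite base_part_of_parts; change (2 * 1)%Z with 2%Z.
    rewrite phi_pow_add, phi_pow_1, phi_pow_2.
    unfold tau; field_simplify_eq; [|auto using root5_neq_0, phi_neq_0].
    rewrite root5_phi; ring [(phi_sq s)].
  - rewrite (root_part_gamma_el _ _ _ _ _ (E s)), root_part_phi_unit_mul, root_part_conj.
    unfold delta; rewrite root_part_of_parts; change (2 * 1)%Z with 2%Z.
    rewrite phi_pow_add, phi_pow_1, phi_pow_2.
    unfold tau; field_simplify_eq; [ring [(phi_sq s)]|auto using root5_neq_0, phi_neq_0].
Qed.

Lemma gamma_odd_assoc (x y : R) (i : Z) :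
  (forall s, x + y * root5 s = 2 * phi_pow s (4 * i + 1)) ->
  assoc p (gamma_el (-1) x y) (delta (- i)).
Proof.
  intros E; rewrite (gamma_odd x y i E).
  apply assoc_trans with (elconj true false (delta i)); [apply assoc_phi_unit_mul|].
  apply assoc_sym, delta_opp_assoc_conj.
Qed.

Lemma assoc_gamma_family_rep (j : nat) (x y : R) : (1 <= j)%nat ->
  (forall s, x + y * root5 s = 2 * phi_pow s (2 * Z.of_nat j - 1)) ->
  assoc p (gamma_el ((-1) ^ j) x y) (family_rep (S j)).
Proof.
  intros Hj E; unfold family_rep; destruct (Nat.Even_or_Odd j) as [[i ->]|[i ->]].
  - rewrite pow_1_even; replace (S (2 * i)) with (2 * i + 1)%nat by lia.
    rewrite delta_index_odd by lia; replace (gamma_el 1 x y) with (delta (Z.of_nat i));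
      [apply assoc_refl|symmetry; apply gamma_even].
    intros s; rewrite E; do 2 f_equal; lia.
  - replace ((-1) ^ (2 * i + 1)) with (-1) by (rewrite Nat.add_1_r; symmetry; apply pow_1_odd).
    replace (S (2 * i + 1)) with (2 * (i + 1))%nat by lia; rewrite delta_index_even.
    replace (1 - Z.of_nat (i + 1))%Z with (- Z.of_nat i)%Z by lia; apply gamma_odd_assoc.
    intros s; rewrite E; do 2 f_equal; lia.
Qed.

Lemma assoc_rho_family_rep : assoc p (El ((IZR X + IZR Y) / 2) 0 (- 1 / 2) (1 / 2)) (family_rep 1).
Proof. rewrite rho_eq_delta; apply assoc_phi_unit_mul. Qed.

Lemma ln_disc_bounds :
  8 * ln (phi true) * (IZR (2 * h + 1) - 1) <= ln ((20 * IZR p) ^ 2) <=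
  8 * ln (phi true) * IZR (2 * h + 1).
Proof.
  assert (Hp0 : 0 < IZR p) by (apply IZR_lt, p_pos); pose proof phi_true_bounds.
  pose proof (phi_pow_opp_r true (4 * h - 1)); assert (HX := X_phi true); assert (HX2 := X_sq).
  pose proof (phi_pow_true_lt_1 (- (4 * h - 1)) ltac:(lia)).
  pose proof (phi_pow_true_pos (- (4 * h - 1))).
  assert (Hphi3 : phi_pow true 3 <= phi_pow true (4 * h - 1)) by (apply phi_pow_true_le; lia).
  change 3%Z with (2 + 1)%Z in Hphi3; rewrite phi_pow_add, phi_pow_1, phi_pow_2 in Hphi3.
  set (q := phi_pow true (4 * h - 1)) in *; set (q' := phi_pow true (- (4 * h - 1))) in *.
  assert (H20p : 20 * IZR p = 4 * (q * q) + 4 * (q' * q') - 12) by (rewrite HX in HX2; lra).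
  assert (Lower : phi_pow true (8 * h) <= 20 * IZR p).
  { replace (8 * h)%Z with ((4 * h - 1) + (4 * h - 1) + 2)%Z by lia.
    rewrite !phi_pow_add, phi_pow_2.
    fold q; rewrite H20p; nra. }
  assert (Upper : 20 * IZR p <= phi_pow true (8 * h + 4)).
  { replace (8 * h + 4)%Z with ((4 * h - 1) + (4 * h - 1) + (4 + 2))%Z by lia.
    rewrite !phi_pow_add, phi_pow_2, phi_pow_4.
    fold q; rewrite H20p; nra. }
  apply ln_le_iff in Lower; [|apply phi_pow_true_pos|lra].
  apply ln_le_iff in Upper; [|lra|apply phi_pow_true_pos].
  rewrite ln_phi_pow in Lower, Upper.
  replace ((20 * IZR p) ^ 2) with ((20 * IZR p) * (20 * IZR p)) by ring.
  rewrite ln_mult by lra; rewrite ?plus_IZR, ?mult_IZR in *; lra.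
Qed.

Lemma disc_bounds :
  ln ((20 * IZR p) ^ 2) / (8 * ln (phi true)) <= IZR (2 * h + 1) <=
  ln ((20 * IZR p) ^ 2) / (8 * ln (phi true)) + 1.
Proof.
  destruct ln_disc_bounds as [Lower Upper]; pose proof ln_phi_pos.
  split; [|apply Rplus_le_reg_r with (-1)]; apply Rmult_le_reg_r with (8 * ln (phi true));
    try lra; field_simplify; lra.
Qed.

End Family.
End BiquadraticField.

(** * The sequences [x] and [y] *)

Section Sequences.
Variables x y : nat -> Z.
Hypothesis xy_spec :
  forall k : nat, (IZR (x k) + IZR (y k) * sqrt 5) / 2 = ((1 + sqrt 5) / 2) ^ k.

Lemma xy_phi_pow (k : nat) (s : bool) :
  IZR (x k) + IZR (y k) * root5 s = 2 * phi_pow s (Z.of_nat k).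
Proof.
  assert (Hz : in_Zphi (fun s => IZR (x k) + IZR (y k) * root5 s - 2 * phi_pow s (Z.of_nat k)))
    by auto with zphi.
  apply Rminus_diag_uniq; revert s; apply in_Zphi_zero with (1 := Hz) (s := true).
  assert (Htrue := xy_spec k); rewrite <- root5_true in Htrue; fold (phi true) in Htrue.
  unfold phi_pow; rewrite <- pow_powerRZ, <- Htrue; field.
Qed.

Lemma xy_odd_phi_pow (k : nat) (s : bool) : let m := Z.of_nat (2 * k + 1) in
  IZR (x (2 * k + 1)) = phi_pow s m - phi_pow s (- m) /\
  root5 s * IZR (y (2 * k + 1)) = phi_pow s m + phi_pow s (- m).
Proof.
  pose proof (xy_phi_pow (2 * k + 1) s); assert (Hconj := xy_phi_pow (2 * k + 1) (negb s)).
  replace (Z.of_nat (2 * k + 1)) with (2 * Z.of_nat k + 1)%Z in * by lia.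
  rewrite phi_pow_negb_odd, root5_negb in Hconj; cbv zeta; lra.
Qed.

Lemma y_mul3_even (k : nat) : exists b, y (3 * k) = (2 * b)%Z.
Proof.
  assert (Hpow : exists a b : Z, forall s, phi_pow s (Z.of_nat (3 * k)) = IZR a + IZR b * root5 s).
  { induction k as [|k (a&b&IH)]; [exists 1%Z, 0%Z; intros s; simpl; ring|].
    exists (2 * a + 5 * b)%Z, (a + 2 * b)%Z; intros s.
    replace (Z.of_nat (3 * S k)) with (Z.of_nat (3 * k) + (2 + 1))%Z by lia.
    rewrite !phi_pow_add, IH, phi_pow_2, phi_pow_1, !plus_IZR, !mult_IZR.
    replace ((phi s + 1) * phi s) with (2 + root5 s) by (rewrite root5_phi; ring [(phi_sq s)]).
    ring [(root5_sq s)]. }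
  destruct Hpow as (a&b&Hpow); exists b; apply eq_IZR; rewrite mult_IZR.
  assert (Htrue := xy_phi_pow (3 * k) true); assert (Hfalse := xy_phi_pow (3 * k) (negb true)).
  rewrite Hpow in Htrue, Hfalse; rewrite root5_negb in Hfalse.
  apply Rmult_eq_reg_r with (root5 true); [lra|apply root5_neq_0].
Qed.

Section FamilyParameters.
Variable n : nat.
Notation h := (3 * Z.of_nat n + 1)%Z.
Notation X := (x (12 * n + 3)).
Notation Y := (y (12 * n + 3)).

Lemma X_phi_pow (s : bool) : IZR X = phi_pow s (4 * h - 1) - phi_pow s (- (4 * h - 1)).
Proof.
  replace (4 * h - 1)%Z with (Z.of_nat (2 * (6 * n + 1) + 1)) by lia.
  replace (12 * n + 3)%nat with (2 * (6 * n + 1) + 1)%nat by lia; apply xy_odd_phi_pow.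
Qed.

Lemma Y_phi_pow (s : bool) : root5 s * IZR Y = phi_pow s (4 * h - 1) + phi_pow s (- (4 * h - 1)).
Proof.
  replace (4 * h - 1)%Z with (Z.of_nat (2 * (6 * n + 1) + 1)) by lia.
  replace (12 * n + 3)%nat with (2 * (6 * n + 1) + 1)%nat by lia; apply xy_odd_phi_pow.
Qed.

Lemma radicand_family : Zsqfree (Y ^ 2 - 1) -> Zsqfree (X ^ 2 - 1) -> radicand (Y ^ 2 - 1).
Proof.
  intros Hp Hr; split.
  - assert (HY := Y_gt_1 h X Y ltac:(lia) X_phi_pow Y_phi_pow); apply lt_IZR in HY; nia.
  - assumption.
  - replace (5 * (Y ^ 2 - 1))%Z with (X ^ 2 - 1)%Z; [assumption|].
    assert (HX := X_sq (Y ^ 2 - 1) h X Y X_phi_pow Y_phi_pow ltac:(ring)).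
    rewrite <- !mult_IZR, <- plus_IZR in HX; apply eq_IZR in HX; lia.
  - destruct (y_mul3_even (4 * n + 1)) as (b&Hb).
    replace (3 * (4 * n + 1))%nat with (12 * n + 3)%nat in Hb by lia.
    exists (b * b - 1)%Z; rewrite Hb; ring.
Qed.

End FamilyParameters.
End Sequences.

Theorem theorem4p1 (x y : nat -> Z) (n : nat)
  (Hxy : forall m : nat, (IZR (x m) + IZR (y m) * sqrt 5) / 2 = ((1 + sqrt 5) / 2) ^ m)
  (Hp : Zsqfree (y (12 * n + 3)%nat ^ 2 - 1)%Z)
  (Hr : Zsqfree (x (12 * n + 3)%nat ^ 2 - 1)%Z) :
  let X := x (12 * n + 3)%nat in
  let Y := y (12 * n + 3)%nat in
  let p := (Y ^ 2 - 1)%Z in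
  let rho := El ((IZR X + IZR Y) / 2) 0 (- 1 / 2) (1 / 2) in
  let gamma (j : nat) :=
    El ((IZR (y (2 * j - 1)%nat) * IZR X + 1) / 2)
       ((IZR (x (2 * j - 1)%nat) * IZR X - (-1) ^ j) / 10)
       ((-1) ^ j * IZR (x (2 * j - 1)%nat) / 2)
       ((-1) ^ j * IZR (y (2 * j - 1)%nat) / 2) in
  let reps (k : nat) := match k with 0%nat => el1 | 1%nat => rho | S (S k') => gamma (S k') end in
  let w := ln ((1 + sqrt 5) / 2) in
  complete_reps p (6 * n + 3) reps /\
  (forall m : nat, iota_eq p m <-> m = (6 * n + 3)%nat) /\
  (forall D : R, disc_eq p D ->
     ln D / (8 * w) <= INR (6 * n + 3) <= ln D / (8 * w) + 1).
Proof.
  intros X Y p rho gamma reps w.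
  set (h := (3 * Z.of_nat n + 1)%Z).
  assert (h_pos : (1 <= h)%Z) by lia.
  assert (X_phi := X_phi_pow x y Hxy n : forall s, IZR X = _).
  assert (Y_phi := Y_phi_pow x y Hxy n : forall s, root5 s * IZR Y = _).
  assert (p_radicand : radicand p) by (now apply radicand_family with x).
  assert (p_Y : (p = Y * Y - 1)%Z) by (unfold p; ring).
  assert (reps_complete : complete_reps p (6 * n + 3) reps).
  { replace (6 * n + 3)%nat with (Z.to_nat (2 * h + 1)) by lia.
    apply complete_reps_of_assoc with (family_rep h X);
      [assumption|now apply complete_reps_family with Y|].
    intros [|[|j]] _.
    - now apply assoc_refl.
    - now apply assoc_rho_family_rep with (h := h) (Y := Y).
    - apply assoc_gamma_family_rep with (Y := Y) (j := S j); try assumption; [lia|].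
      intros s; rewrite xy_phi_pow by assumption; do 2 f_equal; lia. }
  split; [assumption|split].
  - now apply iota_eq_unique with reps.
  - intros D HD; apply disc_eq_unique in HD; [subst D|assumption].
    assert (bounds := disc_bounds p p_radicand h X Y h_pos X_phi Y_phi p_Y).
    replace (phi true) with ((1 + sqrt 5) / 2) in bounds by (unfold phi; now rewrite root5_true).
    rewrite INR_IZR_INZ; now replace (Z.of_nat (6 * n + 3)) with (2 * h + 1)%Z by lia.
Qed.
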